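(* Let $\Gamma\subset\mathrm{PSL}_2(\mathbb{R})$ be a discrete group such that $\Gamma\setminus\mathbb{H}$ is a complete oriented hyperbolic surface of finite area, with a spin structure given by $\rho$. Then the two class functions $\nu$ and $\varepsilon$ coincide: $\nu(\gamma)=\varepsilon(\gamma)$ for every hyperbolic or parabolic $\gamma\in\Gamma$.
   Context: $\mathbb{H}$ is the upper half plane with metric $(dx^2+dy^2)/y^2$, $J$ its standard almost complex structure, $\Gamma$ has no elliptic elements. Identify the oriented orthonormal frame bundle $P_{SO(2)}\mathbb{H}$ with $\mathrm{PSL}_2(\mathbb{R})$ via $\gamma\mapsto(\gamma i,\{\gamma_{*,i}(\partial/\partial x),\gamma_{*,i}(\partial/\partial y)\})$; the action of $\Gamma$ on frames becomes left multiplication. The spin bundle $P_{\mathrm{Spin}(2)}\mathbb{H}$ is identified with $\mathrm{SL}_2(\mathbb{R})$; $\pi:\mathrm{SL}_2(\mathbb{R})\to\mathrm{PSL}_2(\mathbb{R})$ is the projection. With $\tilde\Gamma:=\pi^{-1}(\Gamma)$, a spin structure on $\Gamma\setminus\mathbb{H}$ is a homomorphism $\rho:\Gamma\to\tilde\Gamma$ with $\pi\circ\rho=\mathrm{Id}_\Gamma$. It determines a homomorphism $\chi:\tilde\Gamma\to\{\pm1\}$ with $\chi(-I_2)=-1$ and $\chi\circ\rho\equiv1$. Definition of $\nu$: for $\gamma\in\Gamma$ let $\tilde\gamma\in\mathrm{SL}_2(\mathbb{R})$ be the unique lift with $\mathrm{Tr}(\tilde\gamma)\ge2$, and $\nu(\gamma):=\chi(\tilde\gamma)$.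 Definition of $\varepsilon$: If $\gamma$ is hyperbolic, let $\eta$ be the unique unit-speed geodesic of $\mathbb{H}$ preserved by $\gamma$ (oriented so that $\gamma$ translates forward), let $p_{\eta(t)}$ be the orthonormal frame $\{-J(\dot\eta(t)),\dot\eta(t)\}$, so $\gamma p_{\eta(t)}=p_{\gamma(\eta(t))}$, and let $\tilde p$ be a (continuous) lift of $p$ to $\mathrm{SL}_2(\mathbb{R})$ along $\eta$. Then $\varepsilon(\gamma)\in\{\pm1\}$ is defined by $\rho(\gamma)\tilde p_{\eta(t)}=\varepsilon(\gamma)\tilde p_{\gamma(\eta(t))}$. If $\gamma$ is parabolic, the definition is the same with $\eta$ replaced by a unit-speed horocycle preserved by $\gamma$ (the result does not depend on the horocycle). *)

(* Defs.v *)
From HB Require Import structures.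
From mathcomp Require Import all_boot all_order all_algebra generic_quotient.
From mathcomp Require Import all_classical all_reals all_analysis.
From mathcomp Require Import complex.

Set Implicit Arguments.
Unset Strict Implicit.
Unset Printing Implicit Defensive.

Import Order.TTheory GRing.Theory Num.Theory.
Import numFieldNormedType.Exports.

Local Open Scope classical_set_scope.
Local Open Scope quotient_scope.
Local Open Scope complex_scope.
Local Open Scope ring_scope.

Local Notation Re := (@complex.Re _).
Local Notation Im := (@complex.Im _).

Section SL2.
Variable R : realType.

Record SL2 := MkSL2 { sl2_mx :> 'M[R]_2; _ : \det sl2_mx == 1 }.

HB.instance Definition _ := [isSub for sl2_mx].
HB.instance Definition _ := [Choice of SL2 by <:].

Implicit Types g h : SL2.

Lemma sl2_det g : \det g = 1. Proof. exact/eqP/(valP g). Qed.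

Fact sl2_one_subproof : \det (1%:M : 'M[R]_2) == 1.
Proof. by rewrite det1. Qed.
Fact sl2_mul_subproof g h : \det (g *m h) == 1.
Proof. by rewrite det_mulmx !sl2_det mulr1. Qed.
Fact sl2_inv_subproof g : \det (\adj g) == 1.
Proof.
have := congr1 determinant (mul_mx_adj g).
by rewrite det_mulmx sl2_det mul1r det1 => ->.
Qed.
Fact sl2_opp_subproof g : \det (- (g : 'M[R]_2)) == 1.
Proof. by rewrite -scaleN1r detZ sl2_det mulr1 sqrrN expr1n. Qed.

Definition sl2_one := MkSL2 sl2_one_subproof.
Definition sl2_mul g h := MkSL2 (sl2_mul_subproof g h).
Definition sl2_inv g := MkSL2 (sl2_inv_subproof g).
Definition sl2_opp g := MkSL2 (sl2_opp_subproof g).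

Fact sl2_mulA : associative sl2_mul.
Proof. by move=> f g h; apply: val_inj; rewrite /= mulmxA. Qed.
Fact sl2_mul1g : left_id sl2_one sl2_mul.
Proof. by move=> g; apply: val_inj; rewrite /= mul1mx. Qed.
Fact sl2_mulg1 : right_id sl2_one sl2_mul.
Proof. by move=> g; apply: val_inj; rewrite /= mulmx1. Qed.
Fact sl2_mulVg : left_inverse sl2_one sl2_inv sl2_mul.
Proof. by move=> g; apply: val_inj; rewrite /= mul_adj_mx sl2_det. Qed.
Fact sl2_mulgV : right_inverse sl2_one sl2_inv sl2_mul.
Proof. by move=> g; apply: val_inj; rewrite /= mul_mx_adj sl2_det. Qed.

HB.instance Definition _ :=
  isGroup.Build SL2 sl2_mulA sl2_mul1g sl2_mulg1 sl2_mulVg sl2_mulgV.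

HB.instance Definition _ := Topological.copy SL2 (initial_topology sl2_mx).

Definition sl2_sim g h := (g == h) || (g == sl2_opp h).

Lemma sl2_oppK : involutive sl2_opp.
Proof. by move=> g; apply: val_inj; rewrite /= opprK. Qed.

Fact sl2_sim_refl : reflexive sl2_sim.
Proof. by move=> g; rewrite /sl2_sim eqxx. Qed.
Fact sl2_sim_sym : symmetric sl2_sim.
Proof.
move=> g h; rewrite /sl2_sim (eq_sym g h); congr (_ || _).
by apply/eqP/eqP => ->; rewrite sl2_oppK.
Qed.
Fact sl2_sim_trans : transitive sl2_sim.
Proof.
move=> h g k; rewrite /sl2_sim.
case/orP=> /eqP-> // /orP[] /eqP->; rewrite ?sl2_oppK eqxx ?orbT //.
Qed.

Canonical sl2_sim_equiv :=
  EquivRel sl2_sim sl2_sim_refl sl2_sim_sym sl2_sim_trans.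

(* SL_2(R) / {I, -I} with the quotient topology *)
Definition PSL2 := quotient_topology {eq_quot sl2_sim}.
HB.instance Definition _ := Choice.on PSL2.
HB.instance Definition _ := Quotient.on PSL2.
HB.instance Definition _ := Topological.on PSL2.

Definition psl_pi : SL2 -> PSL2 := \pi_PSL2.

Lemma psl_piP g h : psl_pi g = psl_pi h <-> g = h \/ g = sl2_opp h.
Proof.
split=> [/(@eqquotP _ _ {eq_quot sl2_sim})|H].
  by rewrite /= /sl2_sim => /orP[] /eqP; [left|right].
apply/(@eqquotP _ _ {eq_quot sl2_sim}); rewrite /= /sl2_sim.
by case: H => ->; rewrite eqxx ?orbT.
Qed.

Lemma psl_reprK (x : PSL2) : psl_pi (repr x) = x.
Proof. exact: reprK. Qed.

Definition psl_one : PSL2 := psl_pi 1%g.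
Definition psl_mul (x y : PSL2) : PSL2 := psl_pi (repr x * repr y)%g.
Definition psl_inv (x : PSL2) : PSL2 := psl_pi (repr x)^-1%g.

Lemma sl2_oppMl g h : (sl2_opp g * h = sl2_opp (g * h))%g.
Proof. by apply: val_inj; rewrite /= mulNmx. Qed.
Lemma sl2_oppMr g h : (g * sl2_opp h = sl2_opp (g * h))%g.
Proof. by apply: val_inj; rewrite /= mulmxN. Qed.

Lemma psl_piM g h : psl_mul (psl_pi g) (psl_pi h) = psl_pi (g * h)%g.
Proof.
rewrite /psl_mul; apply/psl_piP.
have /psl_piP[->|->] := psl_reprK (psl_pi g);
  have /psl_piP[->|->] := psl_reprK (psl_pi h);
  rewrite ?(sl2_oppMl, sl2_oppMr, sl2_oppK); by [left|right].
Qed.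

Fact psl_mulA : associative psl_mul.
Proof.
move=> x y z; rewrite -(psl_reprK x) -(psl_reprK y) -(psl_reprK z).
by rewrite !psl_piM mulgA.
Qed.
Fact psl_mul1g : left_id psl_one psl_mul.
Proof. by move=> x; rewrite -(psl_reprK x) psl_piM mul1g. Qed.
Fact psl_mulg1 : right_id psl_one psl_mul.
Proof. by move=> x; rewrite -(psl_reprK x) psl_piM mulg1. Qed.
Fact psl_mulVg : left_inverse psl_one psl_inv psl_mul.
Proof. by move=> x; rewrite -{2}(psl_reprK x) psl_piM mulVg. Qed.
Fact psl_mulgV : right_inverse psl_one psl_inv psl_mul.
Proof. by move=> x; rewrite -{1}(psl_reprK x) psl_piM mulgV. Qed.

HB.instance Definition _ :=
  isGroup.Build PSL2 psl_mulA psl_mul1g psl_mulg1 psl_mulVg psl_mulgV.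

End SL2.

Section HyperbolicPlane.
Variable R : realType.
Implicit Types (g : SL2 R) (x : PSL2 R) (z v : R[i]) (eta : R -> R[i]).

Definition imagC : R[i] := 0 +i* 1.

Definition upper_half_plane : set R[i] := [set z | 0 < Im z].

Definition mobius g z : R[i] :=
  ((g 0 0)%:C * z + (g 0 1)%:C) / ((g 1 0)%:C * z + (g 1 1)%:C).

(* independent of the representative: mobius (sl2_opp g) = mobius g *)
Definition psl_act x z : R[i] := mobius (repr x) z.

Definition psl_abstr x : R := `|\tr (repr x : 'M[R]_2)|.
Definition hyperbolic x := 2 < psl_abstr x.
Definition parabolic x := psl_abstr x = 2 /\ x <> 1%g.
Definition elliptic x := psl_abstr x < 2.

(* Tangent vectors of the half plane are complex numbers, a + b i standing for
   a d/dx + b d/dy. *)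
Definition derivable_curve eta :=
  forall t : R, derivable (Re \o eta) t 1 /\ derivable (Im \o eta) t 1.
Definition velocity eta (t : R) : R[i] :=
  derive1 (Re \o eta) t +i* derive1 (Im \o eta) t.

Definition hmetric z v w : R := (Re v * Re w + Im v * Im w) / Im z ^+ 2.
Definition Jstd v : R[i] := imagC * v.

(* differential of the action of x, at z, applied to v *)
Definition psl_diff x z v : R[i] :=
  velocity (fun t : R => psl_act x (z + t%:C * v)) 0.

(* The frame at x i that corresponds to x under the identification of the
   oriented orthonormal frame bundle with PSL_2(R). *)
Definition psl_frame x : R[i] * (R[i] * R[i]) :=
  (psl_act x imagC, (psl_diff x imagC 1, psl_diff x imagC imagC)).

Definition unit_speed eta :=
  [/\ forall t, upper_half_plane (eta t),
      derivable_curve eta,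
      derivable_curve (velocity eta)
    & forall t, hmetric (eta t) (velocity eta t) (velocity eta t) = 1].

(* Levi-Civita derivative of the velocity along eta. The nonzero Christoffel
   symbols of (dx^2 + dy^2) / y^2 are, up to symmetry, G^x_xy = G^y_yy = - 1 / y
   and G^y_xx = 1 / y. *)
Definition cov_acceleration eta (t : R) : R[i] :=
  let y := Im (eta t) in
  let v := velocity eta t in
  let a := velocity (velocity eta) t in
  (Re a - 2 * Re v * Im v / y) +i* (Im a + (Re v ^+ 2 - Im v ^+ 2) / y).

Definition unit_speed_geodesic eta :=
  unit_speed eta /\ forall t, cov_acceleration eta t = 0.

(* horizontal lines, and circles of the closed half plane tangent to the real
   axis, without the point of tangency *)
Definition horocycle (C : set R[i]) :=
  (exists2 h : R, 0 < h & C = [set z | Im z = h]) \/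
  (exists x0 : R, exists2 r : R, 0 < r &
     C = [set z | 0 < Im z /\ (Re z - x0) ^+ 2 + (Im z - r) ^+ 2 = r ^+ 2]).

Definition unit_speed_horocycle eta := unit_speed eta /\ horocycle (range eta).

(* x preserves eta and translates it forward *)
Definition translates x eta :=
  exists2 L : R, 0 < L & forall t, psl_act x (eta t) = eta (t + L).

Definition adapted_curve x eta :=
  translates x eta /\
  ((hyperbolic x /\ unit_speed_geodesic eta) \/
   (parabolic x /\ unit_speed_horocycle eta)).

Definition curve_frame eta (t : R) : R[i] * (R[i] * R[i]) :=
  (eta t, (- Jstd (velocity eta t), velocity eta t)).

Definition spin_lift eta (p : R -> SL2 R) :=
  continuous p /\ forall t, psl_frame (psl_pi (p t)) = curve_frame eta t.

End HyperbolicPlane.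

Section SpinStructures.
Variable R : realType.
Implicit Types (Gamma : set (PSL2 R)) (rho : PSL2 R -> SL2 R).
Implicit Types (chi : SL2 R -> R) (x : PSL2 R).

Definition discrete_subset Gamma := Gamma `<=` isolated Gamma.

(* Hyperbolic area of a set of pairs (x, y), each standing for x + i y. *)
Definition harea (F : set (measurableTypeR R * measurableTypeR R)) : \bar R :=
  (\int[(@lebesgue_measure R \x @lebesgue_measure R)%E]_(p in F)
     (p.2 ^- 2)%:E)%E.

(* The quotient is measured on a measurable set of representatives of the
   orbits; when Gamma is discrete without elliptic elements, such a set exists
   and its area does not depend on the choice. *)
Definition finite_area_quotient Gamma :=
  exists F : set (measurableTypeR R * measurableTypeR R),
    [/\ measurable F,
        forall p, F p -> upper_half_plane (p.1 +i* p.2),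
        forall z, upper_half_plane z -> exists! p, F p /\
          exists2 x, Gamma x & p.1 +i* p.2 = psl_act x z
      & (harea F < +oo)%E].

Definition hyperbolic_surface_group Gamma :=
  [/\ group_closed (mem Gamma), discrete_subset Gamma,
      forall x, Gamma x -> ~ elliptic x
    & finite_area_quotient Gamma].

Definition lift_group Gamma : set (SL2 R) := @psl_pi R @^-1` Gamma.

(* Only the values of rho on Gamma matter; these lie in lift_group Gamma by the
   second clause. *)
Definition spin_structure Gamma rho :=
  {in Gamma &, {morph rho : x y / (x * y)%g}} /\
  (forall x, Gamma x -> psl_pi (rho x) = x).

Definition spin_character Gamma rho chi :=
  [/\ forall g, lift_group Gamma g -> chi g = 1 \/ chi g = -1,
      {in lift_group Gamma &, {morph chi : g h / (g * h)%g >-> g * h}},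
      chi (sl2_opp 1%g) = -1
    & forall x, Gamma x -> chi (rho x) = 1].

(* Every non-elliptic x has exactly one lift of trace at least 2. *)
Definition positive_lift x : SL2 R :=
  xget 1%g [set g | psl_pi g = x /\ 2 <= \tr (g : 'M[R]_2)].

Definition nu chi x : R := chi (positive_lift x).

Definition is_epsilon rho x (e : R) :=
  (exists eta p, adapted_curve x eta /\ spin_lift eta p) /\
  (forall eta p, adapted_curve x eta -> spin_lift eta p ->
     forall t t', eta t' = psl_act x (eta t) ->
       (rho x * p t)%g = e *: (p t' : 'M[R]_2) :> 'M[R]_2).

(* The default value 0 is taken only if no sign satisfies the definition. *)
Definition epsilon rho x : R := xget 0 [set e | is_epsilon rho x e].

End SpinStructures.

(* Main.v *)
(* Along a geodesic or a horocycle, the frame lift [p] satisfies [p' = p X] for a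
   fixed trace-zero [X = (1 s; -s -1) / 2], with [s = 0] for geodesics and
   [s = 1] or [s = -1] for horocycles; equivalently [p X p^-1] is constant. So
   [p(t)^-1 p(t')] commutes with [X], which forces its squared trace to be at
   least 4, and by continuity from [t' = t] its trace is at least 2. As [gamma]
   maps the frame at [t] to the frame at [t + L], the positive lift [g] of
   [gamma] satisfies [g p(t) = p(t + L)] or [g p(t) = - p(t + L)], and comparing
   the traces of [g] and [p(t)^-1 p(t + L)] excludes the sign [-1]. *)
Require Import Defs.
From mathcomp Require Import all_boot all_order all_algebra.
From mathcomp Require Import all_classical all_reals all_analysis.
From mathcomp Require Import complex ring lra.

Set Implicit Arguments.
Unset Strict Implicit.
Unset Printing Implicit Defensive.

Local Open Scope classical_set_scope.
Local Open Scope ring_scope.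

Import Order.TTheory GRing.Theory Num.Theory.
Import numFieldNormedType.Exports.

Local Notation Re := (@complex.Re _).
Local Notation Im := (@complex.Im _).

(** A spin lift is only assumed continuous, so the relation p' = p X cannot be differentiated out of
    it. The matrix p X p^-1 is used instead. It does not change under p -> -p, so for given s it
    depends only on the base point and the velocity, and its constancy becomes a statement about the
    curve itself. The number s is the signed curvature; on a horocycle its sign depends on the
    direction of travel. [is_epsilon] adds two obligations. It demands that an adapted curve with a
    lift exist, so such curves are built by integrating p' = p X explicitly. It also admits every t'
    with eta(t') = gamma eta(t), not only t' = t + L, so p(t) has to be determined by eta(t). On the
    other side, chi(rho(gamma)) = 1 and chi(-I) = -1 give rho(gamma) = nu(gamma) g for the positive
    lift g, so g p(t) = p(t') makes nu(gamma) the sign sought. *)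

Section Matrices.
Variable R : realType.
Implicit Types (A B : 'M[R]_2) (g h : SL2 R).

Lemma ord2P (k : 'I_2) : k = 0 \/ k = 1.
Proof. by case: k => -[|[|//]] lt; [left|right]; apply: val_inj. Qed.

Lemma mulmx2E A B i j : (A *m B) i j = A i 0 * B 0 j + A i 1 * B 1 j.
Proof.
rewrite mxE big_ord_recl big_ord1.
by rewrite (_ : lift ord0 ord0 = 1) //; apply: val_inj.
Qed.

Lemma mx2P A B : A 0 0 = B 0 0 -> A 0 1 = B 0 1 -> A 1 0 = B 1 0 ->
  A 1 1 = B 1 1 -> A = B.
Proof.
move=> h00 h01 h10 h11; apply/matrixP => i j.
by case: (ord2P i) => ->; case: (ord2P j) => ->.
Qed.

Lemma mxtrace2 A : \tr A = A 0 0 + A 1 1.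
Proof.
rewrite /mxtrace big_ord_recl big_ord1.
by rewrite (_ : lift ord0 ord0 = 1) //; apply: val_inj.
Qed.

Lemma det_mx2 A : \det A = A 0 0 * A 1 1 - A 0 1 * A 1 0.
Proof.
rewrite (expand_det_row _ 0) big_ord_recl big_ord1 /cofactor !det_mx11 !mxE /=.
rewrite (_ : lift ord0 ord0 = 1 :> 'I_2); last exact: val_inj.
rewrite (_ : lift 1 0 = 0 :> 'I_2); last exact: val_inj.
by rewrite expr0 expr1 mulN1r mul1r mulrN.
Qed.

Lemma sl2_det2 g : g 0 0 * g 1 1 - g 0 1 * g 1 0 = 1.
Proof. by rewrite -det_mx2 sl2_det. Qed.

Lemma sl2P g h : g 0 0 = h 0 0 -> g 0 1 = h 0 1 -> g 1 0 = h 1 0 ->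
  g 1 1 = h 1 1 -> g = h.
Proof. by move=> *; apply/val_inj/mx2P. Qed.

Lemma sl2_mulE g h i j : (g * h)%g i j = g i 0 * h 0 j + g i 1 * h 1 j.
Proof. exact: mulmx2E. Qed.

Lemma sl2_oppE g i j : sl2_opp g i j = - g i j.
Proof. by rewrite /= mxE. Qed.

Definition mx2 (a b c d : R) : 'M[R]_2 :=
  \matrix_(i, j) if i == 0 then if j == 0 then a else b
                 else if j == 0 then c else d.

Fact mx2_det (a b c d : R) : a * d - b * c = 1 -> \det (mx2 a b c d) == 1.
Proof. by move=> H; rewrite det_mx2 !mxE /= H. Qed.

Definition sl2_of (a b c d : R) (H : a * d - b * c = 1) : SL2 R := MkSL2
  (mx2_det H).

End Matrices.

(** * The action on the half plane in real coordinates *)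

Section Mobius.
Variable R : realType.
Implicit Types (g h : SL2 R) (z : R[i]) (eta : R -> R[i]).

(** The automorphy factor c z + d: it is a cocycle, and the differential of the action at z is
    division by its square. *)
Definition autj g z : R[i] := (g 1 0)%:C%C * z + (g 1 1)%:C%C.
Definition autn g z : R[i] := (g 0 0)%:C%C * z + (g 0 1)%:C%C.

Lemma mobiusE g z : mobius g z = autn g z / autj g z.
Proof. by []. Qed.

Lemma autj_neq0 g z : 0 < Im z -> autj g z != 0.
Proof.
case: z => x y /= y0; rewrite eq_complex /= !(mul0r,subr0,addr0).
apply/negP => /andP[/eqP h1 /eqP h2].
have := sl2_det2 g; move/eqP: h2; rewrite mulf_eq0 (gt_eqF y0) orbF => /eqP c0.
by move: h1; rewrite c0 mul0r add0r => ->; rewrite !mulr0 subrr => /eqP;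
  rewrite eq_sym oner_eq0.
Qed.

Lemma realCM (a b : R) : (a * b)%:C%C = a%:C%C * b%:C%C :> R[i].
Proof. exact: rmorphM. Qed.
Lemma realCD (a b : R) : (a + b)%:C%C = a%:C%C + b%:C%C :> R[i].
Proof. exact: rmorphD. Qed.

Lemma realCN (a : R) : (- a)%:C%C = - a%:C%C :> R[i].
Proof. exact: rmorphN. Qed.

Lemma autj_mul g h z : 0 < Im z ->
  autj (g * h)%g z = autj g (mobius h z) * autj h z.
Proof.
move=> z0; have := autj_neq0 h z0.
rewrite mobiusE /autj /autn !sl2_mulE !realCD !realCM => hj.
by field.
Qed.

Lemma autn_mul g h z : 0 < Im z ->
  autn (g * h)%g z = autn g (mobius h z) * autj h z.
Proof.
move=> z0; have := autj_neq0 h z0.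
rewrite mobiusE /autj /autn !sl2_mulE !realCD !realCM => hj.
by field.
Qed.

(** This is |c z + d|^2 at z = x + i y, kept real so that the coordinates of the action are real
    rational functions, to which real calculus applies. *)
Definition autj_normsq g (x y : R) : R :=
  (g 1 0 * x + g 1 1) ^+ 2 + (g 1 0 * y) ^+ 2.

Lemma autj_normsq_neq0 g (x y : R) : 0 < y -> autj_normsq g x y != 0.
Proof.
move=> y0; have := @autj_neq0 g (x +i* y)%C y0.
rewrite eq_complex /= !(mul0r,subr0,addr0) => nz.
rewrite paddr_eq0 ?sqr_ge0 // !sqrf_eq0.
by apply: contra nz => /andP[-> /eqP]; rewrite mulrC => ->; rewrite eqxx.
Qed.

(* With the convention 1 / 0 = 0 the formula holds at the pole as well. *)
Lemma mobius_coord g (x y : R) :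
  mobius g (x +i* y)%C =
   (((g 0 0 * x + g 0 1) * (g 1 0 * x + g 1 1) + g 0 0 * g 1 0 * y ^+ 2) /
      autj_normsq g x y +i* (y / autj_normsq g x y))%C.
Proof.
apply/eqP; rewrite eq_complex /= !(mul0r,subr0,addr0).
rewrite -/(autj_normsq g x y).
have [->|n0] := eqVneq (autj_normsq g x y) 0.
  by rewrite invr0 !mulr0 oppr0 !mulr0 subr0 addr0 eqxx.
apply/andP; split; apply/eqP; first by field.
transitivity ((g 0 0 * g 1 1 - g 0 1 * g 1 0) * y / autj_normsq g x y).
  by field.
by rewrite sl2_det2 mul1r.
Qed.

End Mobius.

(** * Real derivatives, and continuous functions that cannot change sign *)

Section Derivatives.
Variable R : realType.
Implicit Types (f g : R -> R) (t : R).

Lemma is_deriveD1 f g t df dg : is_derive t 1 f df -> is_derive t 1 g dg ->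
  is_derive t 1 (fun s => f s + g s) (df + dg).
Proof. by move=> Df Dg; exact: (is_deriveD Df Dg). Qed.

Lemma is_deriveM1 f g t df dg : is_derive t 1 f df -> is_derive t 1 g dg ->
  is_derive t 1 (fun s => f s * g s) (df * g t + f t * dg).
Proof.
move=> Df Dg; apply: (is_derive_eq (is_deriveM Df Dg)).
by rewrite /GRing.scale /= addrC [g t * df]mulrC.
Qed.

Lemma is_deriveV1 f t df : f t != 0 -> is_derive t 1 f df ->
  is_derive t 1 (fun s => (f s)^-1) (- df / f t ^+ 2).
Proof.
move=> ft0 H; apply: (is_derive_eq (is_deriveV ft0 H)).
by rewrite /GRing.scale /= !mulNr mulrC.
Qed.

Lemma is_derive_cont f t df : is_derive t 1 f df -> {for t, continuous f}.
Proof. by case=> /derivable1_diffP/differentiable_continuous. Qed.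

Lemma nonvanishing_sign f (a b : R) :
  continuous f -> (forall t, f t != 0) -> 0 < f a -> 0 < f b.
Proof.
move=> cf f0 fa; rewrite ltNge le_eqVlt (negPf (f0 b)) /=; apply/negP => fb.
have [le|/ltW le] := leP a b.
  have [||c _ fc] := @IVT R f _ _ 0 le; first exact: continuous_subspaceT.
    by rewrite minElt maxElt ltNge (ltW (lt_trans fb fa)) /= !ltW.
  by have := f0 c; rewrite fc eqxx.
have [||c _ fc] := @IVT R f _ _ 0 le; first exact: continuous_subspaceT.
  by rewrite minElt maxElt (lt_trans fb fa) /= !ltW.
by have := f0 c; rewrite fc eqxx.
Qed.

(** Applied to the signed curvature of a horocycle: its square is 1, so the direction of travel
    never reverses. *)
Lemma sqr1_const f (a b : R) : continuous f -> (forall t, f t ^+ 2 = 1) ->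
  f a = f b.
Proof.
move=> cf f1.
have f0 t : f t != 0 by rewrite -sqrf_eq0 f1 oner_eq0.
have pos s t : 0 < f s -> f s = f t.
  move=> fs; have ft := nonvanishing_sign t cf f0 fs.
  by apply/eqP; rewrite -(eqrXn2 (n := 2)) ?ltW // !f1.
have [/pos //|ha] := ltP 0 (f a).
have [/(pos b a) //|hb] := ltP 0 (f b).
by apply/oppr_inj/eqP; rewrite -(eqrXn2 (n := 2)) ?oppr_ge0 // !sqrrN !f1.
Qed.

End Derivatives.

(** * Velocities of curves and the differential of a Möbius map *)

Section Velocity.
Variable R : realType.
Implicit Types (g : SL2 R) (z v : R[i]) (eta : R -> R[i]).

(** A relation rather than a function, so that it carries derivability, which a value of [velocity]
    does not. *)
Definition has_velocity eta (t : R) v :=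
  is_derive t 1 (fun s => Re (eta s)) (Re v) /\
  is_derive t 1 (fun s => Im (eta s)) (Im v).

Lemma has_velocityE eta t v : has_velocity eta t v -> velocity eta t = v.
Proof.
case: v => u w [/= [_ h1] [_ h2]].
by rewrite /velocity !derive1E; congr (_ +i* _)%C.
Qed.

Lemma derivable_curveP eta : derivable_curve eta <->
  forall t, has_velocity eta t (velocity eta t).
Proof.
split=> H t.
  by have [h1 h2] := H t; split; rewrite /= derive1E; apply: derivableP.
by have [[h1 _] [h2 _]] := H t.
Qed.

Lemma has_velocity_shift eta (L t : R) v : has_velocity eta (t + L) v ->
  has_velocity (fun s => eta (s + L)) t v.
Proof.
have D : is_derive t 1 (fun s : R => s + L) 1.
  by apply: (is_derive_eq (is_deriveD1 (is_derive_id t 1) (is_derive_cst L t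
    1))); rewrite addr0.
case=> h1 h2; split.
  by apply: (is_derive_eq (@is_derive1_comp _ (fun s => Re (eta s)) (fun s => s
    + L) _ _ _ h1 D)); rewrite mulr1.
by apply: (is_derive_eq (@is_derive1_comp _ (fun s => Im (eta s)) (fun s => s +
  L) _ _ _ h2 D)); rewrite mulr1.
Qed.

Lemma has_velocity_line z v : has_velocity (fun t : R => z + t%:C%C * v) 0 v.
Proof.
case: z v => x y [u w]; split => /=.
  rewrite (_ : (fun s => _) = fun s => x + s * u); last first.
    by apply/funext => s; rewrite mul0r subr0.
  apply: (is_derive_eq (is_deriveD1 (is_derive_cst _ _ _) (is_deriveM1
    (is_derive_id _ _) (is_derive_cst _ _ _)))).
  by rewrite /=; ring.
rewrite (_ : (fun s => _) = fun s => y + s * w); last first.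
  by apply/funext => s; rewrite mul0r addr0.
apply: (is_derive_eq (is_deriveD1 (is_derive_cst _ _ _) (is_deriveM1
  (is_derive_id _ _) (is_derive_cst _ _ _)))).
by rewrite /=; ring.
Qed.

End Velocity.

Section VelocityMobius.
Variable R : realType.
Implicit Types (g p : SL2 R) (z v : R[i]) (eta : R -> R[i]).

Lemma complexRI z : z = (Re z +i* Im z)%C.
Proof. by case: z. Qed.

(** Multiply numerator and denominator by (a - i b)^2; the denominator becomes |c z + d|^4. *)
Lemma div_autj_sqr g (x y u w : R) : 0 < y ->
  let a := g 1 0 * x + g 1 1 in let b := g 1 0 * y in
  ((u +i* w) / autj g (x +i* y) ^+ 2)%C =
  (((u * (a ^+ 2 - b ^+ 2) + 2 * a * b * w) / autj_normsq g x y ^+ 2) +i*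
   ((w * (a ^+ 2 - b ^+ 2) - 2 * a * b * u) / autj_normsq g x y ^+ 2))%C.
Proof.
move=> y0 a b; have := autj_normsq_neq0 g x y0.
have -> : autj g (x +i* y)%C = (a +i* b)%C.
  by apply/eqP; rewrite eq_complex /= !(mul0r, subr0, addr0) !eqxx.
rewrite /autj_normsq -/a -/b => n0.
have D : (a * a - b * b) ^+ 2 + (a * b + b * a) ^+ 2 = (a ^+ 2 + b ^+ 2) ^+ 2.
  by ring.
apply/eqP; rewrite eq_complex /= D; apply/andP; split; apply/eqP; field; exact:
  n0.
Qed.

Lemma has_velocity_mobius g eta (t : R) v : 0 < Im (eta t) ->
  has_velocity eta t v ->
  has_velocity (fun s => mobius g (eta s)) t (v / autj g (eta t) ^+ 2).
Proof.
move=> y0 [Dx Dy].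
have n0 := autj_normsq_neq0 g (Re (eta t)) y0.
have E s : mobius g (eta s) = mobius g (Re (eta s) +i* Im (eta s))%C.
  by case: (eta s).
have K (k : R) := is_derive_cst k t (1 : R).
have Dlin (a b : R) := is_deriveD1 (is_deriveM1 (K a) Dx) (K b).
have Dn := is_deriveV1 (f := fun s => autj_normsq g (Re (eta s)) (Im (eta s)))
  n0
  (is_deriveD1 (is_deriveM1 (Dlin (g 1 0) (g 1 1)) (Dlin (g 1 0) (g 1 1)))
     (is_deriveM1 (is_deriveM1 (K (g 1 0)) Dy) (is_deriveM1 (K (g 1 0)) Dy))).
rewrite [eta t]complexRI [v]complexRI div_autj_sqr //.
split=> /=.
  under eq_fun do rewrite E mobius_coord /=.
  apply: (is_derive_eq (is_deriveM1 (is_deriveD1 (is_deriveM1 (Dlin (g 0 0) (g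
    0 1)) (Dlin (g 1 0) (g 1 1)))
     (is_deriveM1 (K (g 0 0 * g 1 0)) (is_deriveM1 Dy Dy))) Dn)).
  (* The real part agrees only modulo determinant 1. Inserting the determinant as a factor gives an
     identity valid for all entries. *)
  rewrite /= -[RHS]mul1r -[X in _ = X * _](sl2_det2 g).
  move: n0; rewrite /autj_normsq => n0.
  by field.
under eq_fun do rewrite E mobius_coord /=.
apply: (is_derive_eq (is_deriveM1 Dy Dn)) => /=.
move: n0; rewrite /autj_normsq => n0.
by field.
Qed.

End VelocityMobius.

(** * Frames as elements of the group *)

Section Frames.
Variable R : realType.
Implicit Types (g h p : SL2 R) (z v : R[i]) (eta : R -> R[i]).

Lemma mobius_opp g z : mobius (sl2_opp g) z = mobius g z.
Proof.
rewrite !mobiusE /autn /autj !sl2_oppE !realCN !mulNr -!opprD.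
by rewrite invrN mulrNN.
Qed.

Lemma psl_act_pi g z : psl_act (psl_pi g) z = mobius g z.
Proof.
rewrite /psl_act; have /psl_piP[->//|->] := psl_reprK (psl_pi g).
exact: mobius_opp.
Qed.

Lemma mobius_im_gt0 g z : 0 < Im z -> 0 < Im (mobius g z).
Proof.
move=> z0; have := mobius_coord g (Re z) (Im z).
rewrite -complexRI => -> /=; rewrite divr_gt0 //.
by rewrite lt_def autj_normsq_neq0 //= addr_ge0 ?sqr_ge0.
Qed.

Lemma mobiusM g h z : 0 < Im z -> mobius (g * h)%g z = mobius g (mobius h z).
Proof.
move=> z0; rewrite !mobiusE autj_mul // autn_mul //.
have := autj_neq0 h z0; have := autj_neq0 g (mobius_im_gt0 h z0).
by rewrite !mobiusE => ? ?; field; apply/andP.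
Qed.

Lemma psl_diff_pi g z v : 0 < Im z ->
  psl_diff (psl_pi g) z v = v / autj g z ^+ 2.
Proof.
move=> z0; apply: has_velocityE.
under eq_fun do rewrite psl_act_pi.
have E : z + (0%:C * v)%C = z by rewrite mul0r addr0.
rewrite -[z in autj g z]E; apply: has_velocity_mobius; first by rewrite E.
exact: has_velocity_line.
Qed.

Lemma psl_frame_pi g : psl_frame (psl_pi g) =
  (mobius g (imagC R),
   (1 / autj g (imagC R) ^+ 2, imagC R / autj g (imagC R) ^+ 2)).
Proof. by rewrite /psl_frame psl_act_pi !psl_diff_pi //= ltr01. Qed.

Lemma imagC2 : imagC R * imagC R = -1.
Proof. by apply/eqP; rewrite eq_complex /=
  !(mul0r,mulr0,mul1r,add0r,sub0r,oppr0) !eqxx. Qed.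

(** On both sides the first vector is -J of the second, so the base point and the second vector
    decide. *)
Lemma frame_piP eta (t : R) g : psl_frame (psl_pi g) = curve_frame eta t <->
  mobius g (imagC R) = eta t /\
  imagC R / autj g (imagC R) ^+ 2 = velocity eta t.
Proof.
rewrite psl_frame_pi /curve_frame; split=> [E|[-> <-]].
  by split; [exact: (congr1 fst E)|exact: (congr1 (snd \o snd) E)].
by rewrite /Jstd mulrA imagC2 -mulNr opprK.
Qed.

Lemma autj_i_inj g h : autj g (imagC R) = autj h (imagC R) ->
  autn g (imagC R) = autn h (imagC R) -> g = h.
Proof.
rewrite /autj /autn /imagC.
move=> /eqP; rewrite eq_complex /= !(mul0r,mulr0,mulr1,addr0,add0r,subr0,oppr0).
case/andP=> /eqP ? /eqP ?.
move=> /eqP; rewrite eq_complex /= !(mul0r,mulr0,mulr1,addr0,add0r,subr0,oppr0).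
by case/andP=> /eqP ? /eqP ?; apply: sl2P.
Qed.

(** The second vectors give equal squares of c i + d, hence equality up to sign; the base points
    then force the same sign on a i + b. These two complex numbers contain all four entries. *)
Lemma frame_inj g h : mobius g (imagC R) = mobius h (imagC R) ->
  imagC R / autj g (imagC R) ^+ 2 = imagC R / autj h (imagC R) ^+ 2 ->
  g = h \/ g = sl2_opp h.
Proof.
have i0 : 0 < Im (imagC R) by rewrite /= ltr01.
have in0 : imagC R != 0 by rewrite eq_complex /= oner_eq0 andbF.
move=> En /(mulfI in0)/invr_inj/eqP; rewrite eqf_sqr.
have {}En : autn g (imagC R) = mobius h (imagC R) * autj g (imagC R).
  by rewrite -En mobiusE divfK // autj_neq0.
have Eh : autn h (imagC R) = mobius h (imagC R) * autj h (imagC R).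
  by rewrite mobiusE divfK // autj_neq0.
case/orP=> /eqP Ej; [left|right]; apply: autj_i_inj.
- by [].
- by rewrite En Ej Eh.
- by rewrite Ej /autj !sl2_oppE !realCN mulNr -opprD.
by rewrite En Ej mulrN -Eh /autn !sl2_oppE !realCN mulNr -opprD.
Qed.

End Frames.

(** * The centralizer of the generator and its traces *)

Section Commutation.
Variable R : realType.
Implicit Types (g h : SL2 R) (s x y u w : R).

Lemma sl2_invE g : [/\ g^-1%g 0 0 = g 1 1, g^-1%g 0 1 = - g 0 1,
  g^-1%g 1 0 = - g 1 0 & g^-1%g 1 1 = g 0 0].
Proof.
have l0 : lift 0 0 = 1 :> 'I_2 by apply: val_inj.
have l1 : lift 1 0 = 0 :> 'I_2 by apply: val_inj.
split; rewrite /= mxE /cofactor det_mx11 !mxE /= ?l0 ?l1 ?expr0 ?expr1 ?mul1r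
  //.
- by rewrite mulN1r.
- by rewrite mulN1r.
by rewrite expr2 mulrNN mul1r mul1r.
Qed.

(* The entries of [2 g X g^-1 = (k2 -k3; k1 -k2)], where [X = (1 s; -s -1) / 2]
   generates the frames along a curve of constant curvature [s]. *)
Definition conj1 s g : R := 2 * g 1 0 * g 1 1 - s * (g 1 0 ^+ 2 + g 1 1 ^+ 2).
Definition conj2 s g : R :=
  g 0 0 * g 1 1 + g 0 1 * g 1 0 - s * (g 0 0 * g 1 0 + g 0 1 * g 1 1).
Definition conj3 s g : R := 2 * g 0 0 * g 0 1 - s * (g 0 0 ^+ 2 + g 0 1 ^+ 2).

Definition same_conj s g h :=
  [/\ conj1 s g = conj1 s h, conj2 s g = conj2 s h & conj3 s g = conj3 s h].

Lemma conj_mxE s g : g *m mx2 1 s (- s) (- 1) *m (g^-1)%g =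
  mx2 (conj2 s g) (- conj3 s g) (conj1 s g) (- conj2 s g).
Proof.
have [i00 i01 i10 i11] := sl2_invE g.
apply: mx2P; rewrite !mulmx2E ?i00 ?i01 ?i10 ?i11 !mxE /= /conj1 /conj2 /conj3;
  ring.
Qed.

(** For M = g^-1 h = (a b; c d), commuting with X means 2 b = s (a - d) and 2 c = -s (a - d).
    Substitute these in (a + d)^2 = (a - d)^2 + 4 (a d - b c) + 4 b c. *)
Lemma sl2_trace_same_conj s g h : same_conj s g h ->
  (\tr (g^-1 * h)%g) ^+ 2 =
  4 + (1 - s ^+ 2) * ((g^-1 * h)%g 0 0 - (g^-1 * h)%g 1 1) ^+ 2.
Proof.
case=> k1 k2 k3; set M := (g^-1 * h)%g.
have comm : M *m mx2 1 s (- s) (- 1) = mx2 1 s (- s) (- 1) *m M.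
  have gV : g^-1%g *m g = 1%:M :> 'M[R]_2 by have /(congr1 val) := mulVg g.
  have hV : h^-1%g *m h = 1%:M :> 'M[R]_2 by have /(congr1 val) := mulVg h.
  have := conj_mxE s h; rewrite -k1 -k2 -k3 -conj_mxE.
  move=> /(congr1 (fun A : 'M[R]_2 => g^-1%g *m (A *m h))).
  rewrite -!mulmxA hV mulmx1 [in RHS]mulmxA gV mul1mx !mulmxA => H.
  exact: H.
clearbody M; have DM := sl2_det2 M.
have := congr1 (fun A : 'M[R]_2 => A 0 0) comm.
have := congr1 (fun A : 'M[R]_2 => A 0 1) comm.
have := congr1 (fun A : 'M[R]_2 => A 1 0) comm.
rewrite !mulmx2E !mxE /= mxtrace2.
move: (M 0 0) (M 0 1) (M 1 0) (M 1 1) DM => a b c d D H10 H01 H00.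
have b2 : 2 * b = s * (a - d) by lra.
have c2 : 2 * c = - s * (a - d) by lra.
have -> : (a + d) ^+ 2 = (a - d) ^+ 2 + 4 * (a * d - b * c) + (2 * b) * (2 * c)
  by ring.
by rewrite D b2 c2; ring.
Qed.

End Commutation.

(** * Conserved quantities of a curve and traces of its lifts *)

Section SpinLifts.
Variable R : realType.
Implicit Types (g h : SL2 R) (eta : R -> R[i]) (p : R -> SL2 R) (s x y u w t :
  R).

Lemma frame_coord g x y u w :
  mobius g (imagC R) = (x +i* y)%C ->
  imagC R / autj g (imagC R) ^+ 2 = (u +i* w)%C ->
  let n := g 1 0 ^+ 2 + g 1 1 ^+ 2 in
  [/\ n != 0, x * n = g 0 0 * g 1 0 + g 0 1 * g 1 1, y * n = 1,
      u * n ^+ 2 = 2 * g 1 0 * g 1 1 & w * n ^+ 2 = g 1 1 ^+ 2 - g 1 0 ^+ 2].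
Proof.
have y1 : 0 < 1 :> R by [].
rewrite mobius_coord div_autj_sqr //.
have := autj_normsq_neq0 g 0 y1; rewrite /autj_normsq.
rewrite !(mulr0, mulr1, add0r, expr1n, mul0r, mul1r) addrC => n0.
case=> <- <- [<- <-]; split=> //; rewrite ?divfK ?sqrf_eq0 //.
- by rewrite addrC.
- by rewrite mulVf.
- by rewrite mulrAC.
by rewrite subr0.
Qed.

(** For s = 0 the three moments are the inner products of v with the Killing fields 1, z and z^2
    (translations, dilations, parabolics fixing 0), the Noether momenta of geodesic motion. The
    terms in s correct them for curvature s. *)
Definition moment1 s (z v : R[i]) : R :=
  (Re v - s * Im z) / Im z ^+ 2.
Definition moment2 s (z v : R[i]) : R :=
  (Re z * Re v + Im z * Im v - s * Re z * Im z) / Im z ^+ 2.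
Definition moment3 s (z v : R[i]) : R :=
  ((Re z ^+ 2 - Im z ^+ 2) * Re v + 2 * Re z * Im z * Im v
    - s * (Re z ^+ 2 + Im z ^+ 2) * Im z) / Im z ^+ 2.

Lemma conj_moment s g z v :
  mobius g (imagC R) = z -> imagC R / autj g (imagC R) ^+ 2 = v ->
  [/\ conj1 s g = moment1 s z v, conj2 s g = moment2 s z v
    & conj3 s g = moment3 s z v].
Proof.
case: z v => x y [u w] Ez Ev.
have [n0 Hx Hy Hu Hw] := frame_coord Ez Ev; have D := sl2_det2 g.
rewrite /conj1 /conj2 /conj3 /moment1 /moment2 /moment3 /=.
move: Hx Hy Hu Hw n0 D; set n := _ ^+ 2 + _.
move: (g 0 0) (g 0 1) (g 1 0) (g 1 1) @n => a b c d n Hx Hy Hu Hw n0 D.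
have y0 : y != 0 by apply: contraNneq (oner_neq0 R) => y0; rewrite -Hy y0 mul0r.
have Ey : y = n^-1 by rewrite -[y](mulfK n0) Hy mul1r.
have Ex : x = (a * c + b * d) / n by rewrite -Hx mulfK.
have Eu : u = 2 * c * d / n ^+ 2 by rewrite -Hu mulfK ?sqrf_eq0.
have Ew : w = (d ^+ 2 - c ^+ 2) / n ^+ 2 by rewrite -Hw mulfK ?sqrf_eq0.
have n0' : c ^+ 2 + d ^+ 2 != 0 by [].
(* The last two identities hold only modulo a d - b c = 1; powers of the determinant make the
   numerators homogeneous first. *)
split; rewrite ?Ex Ey Eu ?Ew.
- by rewrite /n; field.
- transitivity ((2 * (a * c + b * d) * c * d + (d ^+ 2 - c ^+ 2) * (a * d - b *
  c)) / n
     - s * (a * c + b * d)); first by rewrite /n; field.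
  by rewrite D; field.
transitivity ((((a * c + b * d) ^+ 2 - (a * d - b * c) ^+ 2) * (2 * c * d)
   + 2 * (a * c + b * d) * (a * d - b * c) * (d ^+ 2 - c ^+ 2)) / n ^+ 2 -
   s * (((a * c + b * d) ^+ 2 + (a * d - b * c) ^+ 2) / n)).
  by rewrite /n; field.
by rewrite D; field.
Qed.

Definition constant_moments s eta := forall t t',
  [/\ moment1 s (eta t) (velocity eta t) = moment1 s (eta t') (velocity eta t'),
      moment2 s (eta t) (velocity eta t) = moment2 s (eta t') (velocity eta t')
    & moment3 s (eta t) (velocity eta t) = moment3 s (eta t') (velocity eta
      t')].

Lemma spin_lift_same_conj s eta p t t' : constant_moments s eta -> spin_lift
  eta p ->
  same_conj s (p t) (p t').
Proof.
move=> H [_ fr].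
have [/conj_moment Ht /Ht {Ht}Ht] := (frame_piP eta t (p t)).1 (fr t).
have [/conj_moment Ht' /Ht' {Ht'}Ht'] := (frame_piP eta t' (p t')).1 (fr t').
have [h1 h2 h3] := H t t'.
by case: (Ht s) => E1 E2 E3; case: (Ht' s) => E1' E2' E3';
  split; [rewrite E1 E1'|rewrite E2 E2'|rewrite E3 E3'].
Qed.

Lemma continuous_coord p i j : continuous p -> continuous (fun t => p t i j).
Proof.
move=> cp t.
apply: (@continuous_comp _ _ _ p (fun g : SL2 R => g i j)); first exact: cp.
apply: (@continuous_comp _ _ _ (@sl2_mx R) (fun A : 'M[R]_2 => A i j)).
  exact: initial_continuous.
exact: coord_continuous.
Qed.

Lemma spin_lift_trace s eta p t t' : s ^+ 2 <= 1 -> constant_moments s eta ->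
  spin_lift eta p -> 2 <= \tr ((p t)^-1 * p t')%g.
Proof.
move=> s1 H pl.
pose f r : R := \tr ((p t)^-1 * p r)%g.
have f4 r : 4 <= f r ^+ 2.
  rewrite (sl2_trace_same_conj (spin_lift_same_conj t r H pl)) lerDl.
  by rewrite mulr_ge0 ?sqr_ge0 // subr_ge0.
have f0 r : f r != 0.
  by apply/eqP => E; have := f4 r; rewrite E expr0n /= lern0.
have cf : continuous f.
  rewrite (_ : f = fun r => (p t)^-1%g 0 0 * p r 0 0 + (p t)^-1%g 0 1 * p r 1 0
    + ((p t)^-1%g 1 0 * p r 0 1 + (p t)^-1%g 1 1 * p r 1 1)); last first.
    by apply/funext => r; rewrite /f mxtrace2 !mulmx2E.
  have C (k : R) i j r : {for r, continuous (fun r => k * p r i j)}.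
    apply: continuousM; first exact: cst_continuous.
    exact: continuous_coord pl.1 r.
  by move=> r; exact: (continuousD (continuousD (C _ _ _ r) (C _ _ _ r))
    (continuousD (C _ _ _ r) (C _ _ _ r))).
have ft : f t = 2 by rewrite /f mulVg mxtrace1.
have pos : 0 < f t' by apply: (nonvanishing_sign t' cf f0 (a := t)); rewrite ft.
have := f4 t'; rewrite -/(f t') => f4'; nra.
Qed.

End SpinLifts.

(** * Constancy of the moments on geodesics and horocycles *)

Section ConstantMoments.
Variable R : realType.
Implicit Types (eta : R -> R[i]) (s t : R).

Lemma is_derive_const (f : R -> R) k t df : (forall r, f r = k) ->
  is_derive t 1 f df -> df = 0.
Proof.
move=> fk [_ <-]; rewrite (_ : f = cst k); first exact: derive_cst.
exact/funext.
Qed.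

(** Differentiate each moment and eliminate the second derivatives by the geodesic equation. *)
Lemma geodesic_constant_moments eta : unit_speed_geodesic eta ->
  constant_moments 0 eta.
Proof.
case=> -[up /derivable_curveP dv /derivable_curveP da us] geo.
have I t : [/\ is_derive t 1 (fun r => moment1 0 (eta r) (velocity eta r)) 0,
    is_derive t 1 (fun r => moment2 0 (eta r) (velocity eta r)) 0
  & is_derive t 1 (fun r => moment3 0 (eta r) (velocity eta r)) 0].
  have [Dx Dy] := dv t; have [Du Dw] := da t.
  have y0 : Im (eta t) != 0 by rewrite gt_eqF //; exact: up.
  have y20 : Im (eta t) * Im (eta t) != 0 by rewrite mulf_neq0.
  have Dv := is_deriveV1 (f := fun r => Im (eta r) * Im (eta r)) y20
    (is_deriveM1 Dy Dy).
  have [Ax Ay] : Re (velocity (velocity eta) t) =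
       2 * Re (velocity eta t) * Im (velocity eta t) / Im (eta t) /\
     Im (velocity (velocity eta) t) =
       (Im (velocity eta t) ^+ 2 - Re (velocity eta t) ^+ 2) / Im (eta t).
    have /eqP := geo t; rewrite eq_complex /= => /andP[/eqP h1 /eqP h2].
    split; first exact/subr0_eq.
    by apply/eqP; rewrite -subr_eq0 -mulNr opprB; apply/eqP.
  move: Ax Ay y0 Dx Dy Du Dw Dv => + + y0 Dx Dy Du Dw Dv.
  have K (k : R) := is_derive_cst k t (1 : R).
  move=> Ax Ay; rewrite /moment1 /moment2 /moment3; split.
  - rewrite (_ : (fun r => _) = fun r => Re (velocity eta r) * (Im (eta r) * Im
    (eta r))^-1); last first.
      by apply/funext => r; rewrite mul0r subr0.
    apply: (is_derive_eq (is_deriveM1 Du Dv)); by rewrite Ax; field; rewrite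
      ?y0.
  - rewrite (_ : (fun r => _) = fun r => (Re (eta r) * Re (velocity eta r) +
      Im (eta r) * Im (velocity eta r)) * (Im (eta r) * Im (eta r))^-1); last
        first.
      by apply/funext => r; rewrite !mul0r subr0.
    apply: (is_derive_eq (is_deriveM1 (is_deriveD1 (is_deriveM1 Dx Du)
      (is_deriveM1 Dy Dw)) Dv)).
    by rewrite Ax Ay; field.
  rewrite (_ : (fun r => _) = fun r =>
    (((Re (eta r) * Re (eta r) + -1 * (Im (eta r) * Im (eta r))) * Re (velocity
      eta r) +
     2 * (Re (eta r) * (Im (eta r) * Im (velocity eta r)))) * (Im (eta r) * Im
       (eta r))^-1)); last first.
    by apply/funext => r; rewrite !mul0r subr0 !expr2 mulN1r !mulrA.
  apply: (is_derive_eq (is_deriveM1 (is_deriveD1 (is_deriveM1 (is_deriveD1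
    (is_deriveM1 Dx Dx)
    (is_deriveM1 (K (-1)) (is_deriveM1 Dy Dy))) Du)
    (is_deriveM1 (K 2) (is_deriveM1 Dx (is_deriveM1 Dy Dw)))) Dv)).
  by rewrite Ax Ay /=; field.
have cst_of (m : R[i] -> R[i] -> R) t t' :
    (forall r : R, is_derive r (1 : R) (fun r => m (eta r) (velocity eta r)) 0)
      ->
    m (eta t) (velocity eta t) = m (eta t') (velocity eta t').
  by move=> H; exact: (is_derive_0_is_cst (f := fun r => m (eta r) (velocity
    eta r))).
by move=> t t'; split; apply: cst_of => r; have [] := I r.
Qed.

(** Here s is the direction of travel: the velocity is the real number s h, and the moments become
    0, 0 and -2 s h. *)
Lemma horizontal_constant_moments eta (h : R) : unit_speed eta -> 0 < h ->
  (forall t, Im (eta t) = h) -> exists2 s, s ^+ 2 <= 1 & constant_moments s eta.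
Proof.
case=> up /derivable_curveP dv /derivable_curveP da us h0 yh.
have w0 t : Im (velocity eta t) = 0 by exact: is_derive_const yh (dv t).2.
have h0' : h != 0 by rewrite gt_eqF.
pose f t := Re (velocity eta t) / h.
have f2 t : f t ^+ 2 = 1.
  by have := us t; rewrite /hmetric w0 yh mulr0 addr0 /f expr_div_n expr2.
have cf : continuous f.
  move=> t; apply: continuousM; last exact: cst_continuous.
  exact: is_derive_cont (da t).1.
exists (f 0); first by rewrite f2.
have Eu t : Re (velocity eta t) = f 0 * h.
  by rewrite (sqr1_const 0 t cf f2) /f divfK.
by move=> t t'; rewrite /moment1 /moment2 /moment3 !yh !w0 !Eu; split; field.
Qed.

(** The velocity is tangent to the circle and has Euclidean length Im z, so it is determined up to
    the sign s. The moments are then -s / r times 1, x0 and x0^2. *)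
Lemma circle_constant_moments eta (x0 r : R) : unit_speed eta -> 0 < r ->
  (forall t, (Re (eta t) - x0) ^+ 2 + (Im (eta t) - r) ^+ 2 = r ^+ 2) ->
  exists2 s, s ^+ 2 <= 1 & constant_moments s eta.
Proof.
case=> up /derivable_curveP dv /derivable_curveP da us r_gt0 circ.
have r0 : r != 0 by rewrite gt_eqF.
have y0 t : Im (eta t) != 0 by rewrite gt_eqF //; exact: up.
have K (k : R) t := is_derive_cst k t (1 : R).
pose X t := Re (eta t) + - x0; pose Y t := Im (eta t) + - r.
have DX t : is_derive t 1 X _ := is_deriveD1 (dv t).1 (K (- x0) t).
have DY t : is_derive t 1 Y _ := is_deriveD1 (dv t).2 (K (- r) t).
have tang t : X t * Re (velocity eta t) + Y t * Im (velocity eta t) = 0.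
  have := is_derive_const circ (is_deriveD1 (is_deriveM1 (DX t) (DX t))
    (is_deriveM1 (DY t) (DY t))).
  rewrite !addr0 => E; lra.
(* The cross product of radius and velocity, normalized. By Lagrange's identity its square plus that
   of the vanishing inner product is r^2 (Im z)^2 before normalization, so f^2 = 1. *)
pose f t := (X t * Im (velocity eta t) + - Y t * Re (velocity eta t)) * (r * Im
  (eta t))^-1.
have speed t : Re (velocity eta t) ^+ 2 + Im (velocity eta t) ^+ 2 = Im (eta t)
  ^+ 2.
  have := us t; rewrite /hmetric => /(congr1 (fun k => k * Im (eta t) ^+ 2)).
  by rewrite divfK ?sqrf_eq0 // mul1r !expr2.
have ry0 t : r * Im (eta t) != 0 by rewrite mulf_neq0.
have f2 t : f t ^+ 2 = 1.
  rewrite /f expr_div_n; apply: (canLR (mulfK _)); first by rewrite sqrf_eq0.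
  rewrite mul1r exprMn -(circ t) -(speed t).
  transitivity ((X t * Im (velocity eta t) + - Y t * Re (velocity eta t)) ^+ 2 +
    (X t * Re (velocity eta t) + Y t * Im (velocity eta t)) ^+ 2).
    by rewrite tang expr0n addr0.
  by rewrite /X /Y; ring.
have cf : continuous f.
  move=> t; have Cu := is_derive_cont (da t).1; have Cw := is_derive_cont (da
    t).2.
  have CX := is_derive_cont (DX t); have CY := is_derive_cont (DY t).
  have Cy := is_derive_cont (dv t).2.
  apply: (@continuousM _ _ (fun t => _ + _) (fun t => (r * Im (eta t))^-1)).
    apply: (@continuousD _ _ _ (fun t => X t * Im (velocity eta t)) (fun t => -
      Y t * _)).
      exact: continuousM.
    by apply: continuousM => //; exact: continuousN.
  apply: continuousV => //; apply: continuousM => //; exact: cst_continuous.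
exists (f 0); first by rewrite f2.
set s := f 0.
have fs t : X t * Im (velocity eta t) + - Y t * Re (velocity eta t) = s * (r *
  Im (eta t)).
  by rewrite /s (sqr1_const 0 t cf f2) /f divfK.
have Eu t : Re (velocity eta t) = - (Im (eta t) - r) * s * Im (eta t) / r.
  apply: (mulIf (x := r ^+ 2)); first by rewrite sqrf_eq0.
  transitivity (- Y t * (s * (r * Im (eta t)))); last by rewrite /Y; field.
  by rewrite -fs -(circ t) -[LHS]subr0 -[X in _ - X](mulr0 (X t)) -(tang t) /X
    /Y; ring.
have Ew t : Im (velocity eta t) = (Re (eta t) - x0) * s * Im (eta t) / r.
  apply: (mulIf (x := r ^+ 2)); first by rewrite sqrf_eq0.
  transitivity (X t * (s * (r * Im (eta t)))); last by rewrite /X; field.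
  by rewrite -fs -(circ t) -[LHS]subr0 -[X in _ - X](mulr0 (Y t)) -(tang t) /X
    /Y; ring.
have E t : [/\ moment1 s (eta t) (velocity eta t) = - s / r,
    moment2 s (eta t) (velocity eta t) = - s * x0 / r
  & moment3 s (eta t) (velocity eta t) = - s * x0 ^+ 2 / r].
  rewrite /moment1 /moment2 /moment3 Eu Ew; split.
  - by field; rewrite ?r0 ?y0.
  - by field; rewrite ?r0 ?y0.
  transitivity (s / r * ((Re (eta t) - x0) ^+ 2 + (Im (eta t) - r) ^+ 2 - r ^+
    2 - x0 ^+ 2)).
    by field; rewrite ?r0 ?y0.
  by rewrite circ; field.
by move=> t t'; case: (E t) => -> -> ->; case: (E t') => -> -> ->.
Qed.

Lemma adapted_constant_moments x eta : adapted_curve x eta ->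
  exists2 s, s ^+ 2 <= 1 & constant_moments s eta.
Proof.
case=> _ [[_ geo]|[_ [us hor]]].
  by exists 0; [rewrite expr0n ler01|exact: geodesic_constant_moments].
have inC t : range eta (eta t) by exists t.
case: hor => [[h h0 E]|[x0 [r r0 E]]].
  by apply: (horizontal_constant_moments us h0) => t; have := inC t; rewrite E.
by apply: (@circle_constant_moments _ x0 r us r0) => t; have := inC t; rewrite
  E => -[].
Qed.

End ConstantMoments.

(** * Integral curves of the generator *)

Section Flows.
Variable R : realType.
Implicit Types (g h : SL2 R) (eta : R -> R[i]) (p : R -> SL2 R) (s t : R).

Lemma frame_i_coord g (n := g 1 0 ^+ 2 + g 1 1 ^+ 2) :
  [/\ 0 < n, mobius g (imagC R) =
        ((g 0 0 * g 1 0 + g 0 1 * g 1 1) / n +i* n^-1)%C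
    & imagC R / autj g (imagC R) ^+ 2 =
        (2 * g 1 0 * g 1 1 / n ^+ 2 +i* ((g 1 1 ^+ 2 - g 1 0 ^+ 2) / n ^+
          2))%C].
Proof.
have [n0 Hx Hy Hu Hw] := frame_coord (complexRI _) (complexRI (imagC R / autj g
  (imagC R) ^+ 2)).
split.
- by rewrite lt_def n0 addr_ge0 ?sqr_ge0.
- rewrite [LHS]complexRI; congr (_ +i* _)%C; first by rewrite -Hx mulfK.
  by rewrite -[LHS](mulfK n0) Hy mul1r.
by rewrite [LHS]complexRI -Hu -Hw !mulfK ?sqrf_eq0.
Qed.

(* [p' = p X] with [X = (1 s; -s -1) / 2] *)
Definition frame_flow s p := forall t i,
  is_derive t 1 (fun r => p r i 0) ((p t i 0 - s * p t i 1) / 2) /\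
  is_derive t 1 (fun r => p r i 1) ((s * p t i 0 - p t i 1) / 2).

Definition base_curve p t : R[i] := mobius (p t) (imagC R).

(** As a vector field on the half plane, X is s / 2 + z + s z^2 / 2, whose value at i is i for every
    s; p(t) carries this vector to the second vector of its frame. *)
Lemma frame_flow_velocity s p t : frame_flow s p ->
  has_velocity (base_curve p) t (imagC R / autj (p t) (imagC R) ^+ 2).
Proof.
move=> F; have [Da Db] := F t 0; have [Dc Dd] := F t 1.
have [n0 _ ->] := frame_i_coord (p t).
have Dn := is_deriveD1 (is_deriveM1 Dc Dc) (is_deriveM1 Dd Dd).
have n0' : p t 1 0 * p t 1 0 + p t 1 1 * p t 1 1 != 0 by rewrite -!expr2 gt_eqF.
have DV := is_deriveV1 (f := fun r => p r 1 0 * p r 1 0 + p r 1 1 * p r 1 1)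
  n0' Dn.
split.
  rewrite (_ : (fun r => _) = fun r => (p r 0 0 * p r 1 0 + p r 0 1 * p r 1 1) *
     (p r 1 0 * p r 1 0 + p r 1 1 * p r 1 1)^-1); last first.
    by apply/funext => r; rewrite /base_curve; have [_ -> _] := frame_i_coord
      (p r).
  apply: (is_derive_eq (is_deriveM1 (is_deriveD1 (is_deriveM1 Da Dc)
    (is_deriveM1 Db Dd)) DV)).
  rewrite /= -[RHS]mul1r -[X in _ = X * _](sl2_det2 (p t)).
  by field; rewrite -?expr2 gt_eqF.
rewrite (_ : (fun r => _) = fun r => (p r 1 0 * p r 1 0 + p r 1 1 * p r 1
  1)^-1); last first.
  by apply/funext => r; rewrite /base_curve; have [_ -> _] := frame_i_coord (p
    r).
apply: (is_derive_eq DV) => /=.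
by field; rewrite -?expr2 gt_eqF.
Qed.

Lemma velocity_base_curve s p : frame_flow s p -> velocity (base_curve p) =
  fun t => imagC R / autj (p t) (imagC R) ^+ 2.
Proof. by move=> F; apply/funext => t; apply/has_velocityE/(frame_flow_velocity
  t F). Qed.

Lemma frame_flow_acceleration s p t (c := p t 1 0) (d := p t 1 1) (n := c ^+ 2
  + d ^+ 2) :
  frame_flow s p ->
  has_velocity (velocity (base_curve p)) t
    ((s * (c ^+ 2 - d ^+ 2) / n ^+ 2 - 4 * c * d * (c ^+ 2 - d ^+ 2) / n ^+ 3)
      +i*
     ((2 * s * c * d - n) / n ^+ 2 + 2 * (c ^+ 2 - d ^+ 2) ^+ 2 / n ^+ 3))%C.
Proof.
move=> F; rewrite (velocity_base_curve F).
have [Dc Dd] := F t 1.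
have [n0 _ _] := frame_i_coord (p t).
have n0' : p t 1 0 * p t 1 0 + p t 1 1 * p t 1 1 != 0 by rewrite -!expr2 gt_eqF.
have Dn := is_deriveD1 (is_deriveM1 Dc Dc) (is_deriveM1 Dd Dd).
have n0'' : (p t 1 0 * p t 1 0 + p t 1 1 * p t 1 1) * (p t 1 0 * p t 1 0 + p t
  1 1 * p t 1 1) != 0.
  by rewrite mulf_neq0.
have DV := is_deriveV1 (f := fun r => (p r 1 0 * p r 1 0 + p r 1 1 * p r 1 1) *
   (p r 1 0 * p r 1 0 + p r 1 1 * p r 1 1)) n0'' (is_deriveM1 Dn Dn).
have K (k : R) := is_derive_cst k t (1 : R).
split.
  rewrite (_ : (fun r => _) = fun r => (2 * (p r 1 0 * p r 1 1)) *
     ((p r 1 0 * p r 1 0 + p r 1 1 * p r 1 1) * (p r 1 0 * p r 1 0 + p r 1 1 *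
       p r 1 1))^-1); last first.
    by apply/funext => r; have [_ _ ->] := frame_i_coord (p r); rewrite /=
      mulrA.
  apply: (is_derive_eq (is_deriveM1 (is_deriveM1 (K 2) (is_deriveM1 Dc Dd))
    DV)).
  by rewrite /= /n /c /d; field; rewrite -?expr2 gt_eqF.
rewrite (_ : (fun r => _) = fun r => (p r 1 1 * p r 1 1 + -1 * (p r 1 0 * p r 1
  0)) *
     ((p r 1 0 * p r 1 0 + p r 1 1 * p r 1 1) * (p r 1 0 * p r 1 0 + p r 1 1 *
       p r 1 1))^-1); last first.
  by apply/funext => r; have [_ _ ->] := frame_i_coord (p r); rewrite /= mulN1r.
apply: (is_derive_eq (is_deriveM1 (is_deriveD1 (is_deriveM1 Dd Dd) (is_deriveM1
  (K (-1)) (is_deriveM1 Dc Dc))) DV)).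
by rewrite /= /n /c /d; field; rewrite -?expr2 gt_eqF.
Qed.

Lemma frame_flow_unit_speed s p : frame_flow s p -> unit_speed (base_curve p).
Proof.
move=> F; split.
- by move=> t; apply: mobius_im_gt0; rewrite /= ltr01.
- by apply/derivable_curveP => t; rewrite (velocity_base_curve F); exact:
  frame_flow_velocity F.
- apply/derivable_curveP => t.
  by rewrite (has_velocityE (frame_flow_acceleration t F)); exact:
    frame_flow_acceleration.
move=> t; rewrite (velocity_base_curve F) /hmetric /base_curve.
have [n0 -> ->] := frame_i_coord (p t) => /=.
by field; rewrite gt_eqF.
Qed.

Lemma frame_flow_geodesic p : frame_flow 0 p -> unit_speed_geodesic (base_curve
  p).
Proof.
move=> F; split; first exact: frame_flow_unit_speed F.
move=> t; rewrite /cov_acceleration (has_velocityE (frame_flow_acceleration t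
  F)).
rewrite (velocity_base_curve F) /base_curve.
have [n0 -> ->] := frame_i_coord (p t) => /=.
have n0' : p t 1 0 ^+ 2 + p t 1 1 ^+ 2 != 0 by rewrite gt_eqF.
by apply/eqP; rewrite eq_complex /=; apply/andP; split; apply/eqP; field.
Qed.

Lemma frame_flow_spin_lift s p : frame_flow s p -> spin_lift (base_curve p) p.
Proof.
move=> F; split; last first.
  by move=> t; apply/frame_piP; rewrite (velocity_base_curve F).
apply: continuous_comp_initial.
have C i j : continuous (fun t => p t i j).
  move=> t; have [D0 D1] := F t i.
  by case: (ord2P j) => ->; [exact: is_derive_cont D0|exact: is_derive_cont D1].
(* A matrix neighbourhood contains a product of neighbourhoods [P i j] of the finitely many
   entries. *)
move=> t A [P MP sPA].
have : \forall r \near t, forall i, forall j, P i j (p r i j).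
  apply: (filter_forall (f := fun i r => forall j, P i j (p r i j)) (F := nbhs
    t) _) => i.
  apply: (filter_forall (f := fun j r => P i j (p r i j)) (F := nbhs t) _) => j.
  exact: (C i j t _ (MP i j)).
by apply: filterS => r Pr; apply: sPA.
Qed.

End Flows.

(** * An adapted geodesic for a hyperbolic element *)

Section HyperbolicFlow.
Variable R : realType.
Implicit Types (g h : SL2 R) (eta : R -> R[i]) (p : R -> SL2 R) (s t : R).

Lemma sl2_ofE (a b c d : R) (H : a * d - b * c = 1) :
  [/\ sl2_of H 0 0 = a, sl2_of H 0 1 = b, sl2_of H 1 0 = c & sl2_of H 1 1 = d].
Proof. by rewrite /= !mxE. Qed.

Lemma translates_base_curve g p (L : R) : 0 < L ->
  (forall t, (g * p t)%g = p (t + L)) -> translates (psl_pi g) (base_curve p).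
Proof.
move=> L0 H; exists L => // t.
by rewrite psl_act_pi /base_curve -mobiusM ?H //= ltr01.
Qed.

(** The columns (x, z) and (y, w) are eigenvectors scaled to determinant 1. Placing the eigenvalue k
    > 1 first orients the axis so that the translation is forward. *)
Lemma hyperbolic_diagonalization (a b c d : R) : a * d - b * c = 1 -> 2 < a + d
  ->
  exists2 k, 1 < k & exists x y z w, [/\ x * w - y * z = 1,
    a * x + b * z = k * x, a * y + b * w = k^-1 * y,
    c * x + d * z = k * z & c * y + d * w = k^-1 * w].
Proof.
move=> D T; have [c0|c0] := eqVneq c 0.
  have D1 : a * d = 1 by rewrite -D c0; ring.
  have a0 : a != 0 by apply: contraNneq (oner_neq0 R) => a0; rewrite -D1 a0
    mul0r.
  have d0 : d != 0 by apply: contraNneq (oner_neq0 R) => d0; rewrite -D1 d0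
    mulr0.
  have Ed : a^-1 = d by rewrite -[d](mulKf a0) D1 mulr1.
  have Ea : d^-1 = a by rewrite -[a](mulfK d0) D1 mul1r.
  have da : d - a != 0 by apply/eqP => da; nra.
  have [a1|a1] := ltP 1 a.
    exists a => //; exists 1, (b / (d - a)), 0, 1.
    by rewrite c0 Ed; split; field.
  exists d; first by lra.
  by exists (b / (d - a)), (-1), 1, 0; rewrite c0 Ea; split; field.
pose r := Num.sqrt ((a + d) ^+ 2 - 4).
have r2 : r ^+ 2 = (a + d) ^+ 2 - 4 by rewrite sqr_sqrtr //; nra.
have r0 : 0 < r by rewrite sqrtr_gt0; nra.
pose k := (a + d + r) / 2; pose l := (a + d - r) / 2.
have kl : k * l = 1.
  transitivity (((a + d) ^+ 2 - r ^+ 2) / 4); first by rewrite /k /l; field.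
  by rewrite r2; field.
have k0 : k != 0 by apply: contraNneq (oner_neq0 R) => k0; rewrite -kl k0 mul0r.
have El : k^-1 = l by rewrite -[l](mulKf k0) kl mulr1.
have kr : k - l = r by rewrite /k /l; field.
have ks : k + l = a + d by rewrite /k /l; field.
exists k; first by rewrite /k; lra.
have r0' : r != 0 by rewrite gt_eqF.
(* The eigenvectors are (k - d, c) and (l - d, c), of determinant c (k - l) = c r; the first one is
   divided by c r. *)
exists ((k - d) / (c * r)), (l - d), r^-1, c; rewrite El.
clearbody k l r; have Ea : a = k + l - d by rewrite ks; ring.
have Eb : b = (a * d - k * l) / c by rewrite kl -D; field.
rewrite Eb Ea; split.
- by rewrite -kr; field; rewrite kr r0' c0.
- by field; rewrite r0' c0.
- by field.
- by field; rewrite r0' c0.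
by ring.
Qed.

(** With Q the matrix of eigenvectors, p(t) = Q diag(e^(t/2), e^(-t/2)). Left multiplication by g
    inserts diag(k, 1/k) after Q, a time shift by 2 ln k. *)
Lemma hyperbolic_adapted g : 2 < \tr g -> exists p, frame_flow 0 p /\
  translates (psl_pi g) (base_curve p).
Proof.
rewrite mxtrace2 => T.
have [k k1 [x [y [z [w [D e00 e01 e10 e11]]]]]] := hyperbolic_diagonalization
  (sl2_det2 g) T.
have k0 : 0 < k by lra.
have Dt t : (x * expR (t / 2)) * (w * expR (- (t / 2))) -
    (y * expR (- (t / 2))) * (z * expR (t / 2)) = 1.
  transitivity ((x * w - y * z) * (expR (t / 2) * expR (- (t / 2)))); first by
    ring.
  by rewrite D expRxMexpNx_1 mulr1.
exists (fun t => sl2_of (Dt t)); split.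
  move=> t i.
  have DE : is_derive t 1 (fun r : R => expR (r / 2)) (expR (t / 2) / 2).
    have D2 := is_deriveM1 (is_derive_id t 1) (is_derive_cst (2^-1 : R) t 1).
    apply: (is_derive_eq (@is_derive1_comp _ (@expR R) (fun r => r / 2) _ _ _
      (is_derive_expR _) D2)).
    by rewrite /=; field.
  have DN : is_derive t 1 (fun r : R => expR (- (r / 2))) (- expR (- (t / 2)) /
    2).
    have D2 := is_deriveM1 (is_derive_id t 1) (is_derive_cst (- 2^-1 : R) t 1).
    rewrite (_ : (fun r : R => _) = fun r => expR (r * (- 2^-1))); last first.
      by apply/funext => r; rewrite mulrN.
    apply: (is_derive_eq (@is_derive1_comp _ (@expR R) (fun r => r * (- 2^-1))
      _ _ _ (is_derive_expR _) D2)).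
    by rewrite /= mulrN; field.
  have K (q : R) := is_derive_cst q t (1 : R).
  split.
    rewrite (_ : (fun r => _) = fun r => (if i == 0 then x else z) * expR (r /
      2)); last first.
      by apply/funext => r; rewrite /= mxE /=; case: ifP.
    apply: (is_derive_eq (is_deriveM1 (K _) DE)).
    by rewrite /= !mxE /=; case: (ord2P i) => -> /=; field.
  rewrite (_ : (fun r => _) = fun r => (if i == 0 then y else w) * expR (- (r /
    2))); last first.
    by apply/funext => r; rewrite /= mxE /=; case: ifP.
  apply: (is_derive_eq (is_deriveM1 (K _) DN)).
  by rewrite /= !mxE /=; case: (ord2P i) => -> /=; field.
apply: (translates_base_curve (L := 2 * ln k)).
  by rewrite mulr_gt0 // ln_gt0.
move=> t.
have E1 : expR ((t + 2 * ln k) / 2) = expR (t / 2) * k.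
  by rewrite mulrDl expRD [2 * _]mulrC mulfK // lnK.
have E2 : expR (- ((t + 2 * ln k) / 2)) = expR (- (t / 2)) * k^-1.
  by rewrite !expRN E1 invfM.
have [h00 h01 h10 h11] := sl2_ofE (Dt t).
have [j00 j01 j10 j11] := sl2_ofE (Dt (t + 2 * ln k)).
apply: sl2P; rewrite sl2_mulE ?h00 ?h01 ?h10 ?h11 ?j00 ?j01 ?j10 ?j11 ?E1 ?E2.
- by rewrite !mulrA -mulrDl e00; ring.
- by rewrite !mulrA -mulrDl e01; ring.
- by rewrite !mulrA -mulrDl e10; ring.
by rewrite !mulrA -mulrDl e11; ring.
Qed.

End HyperbolicFlow.

(** * An adapted horocycle for a parabolic element *)

Section Parabolic.
Variable R : realType.
Implicit Types (g h P : SL2 R) (eta : R -> R[i]) (p : R -> SL2 R) (s t : R).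

Fact linear_flow_det P s t : s ^+ 2 = 1 ->
  (P 0 0 + t / 2 * (P 0 0 - s * P 0 1)) * (P 1 1 + t / 2 * (s * P 1 0 - P 1 1))
    -
  (P 0 1 + t / 2 * (s * P 0 0 - P 0 1)) * (P 1 0 + t / 2 * (P 1 0 - s * P 1 1))
    = 1.
Proof.
move=> s1.
transitivity ((P 0 0 * P 1 1 - P 0 1 * P 1 0) * (1 - t ^+ 2 / 4 * (1 - s ^+
  2))).
  by field.
by rewrite s1 subrr mulr0 subr0 mulr1 sl2_det2.
Qed.

(* [P (1 + t X) = P exp (t X)], as [X ^+ 2 = 0] when [s ^+ 2 = 1] *)
Definition linear_flow P s (s1 : s ^+ 2 = 1) t : SL2 R :=
  sl2_of (linear_flow_det P t s1).

Lemma linear_flowE P s (s1 : s ^+ 2 = 1) t i :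
  linear_flow P s1 t i 0 = P i 0 + t / 2 * (P i 0 - s * P i 1) /\
  linear_flow P s1 t i 1 = P i 1 + t / 2 * (s * P i 0 - P i 1).
Proof. by case: (ord2P i) => ->; rewrite /= !mxE. Qed.

Lemma frame_flow_linear P s (s1 : s ^+ 2 = 1) : frame_flow s (linear_flow P s1).
Proof.
move=> t i; have K (q : R) := is_derive_cst q t (1 : R).
have DL (q r : R) : is_derive t 1 (fun t : R => q + t / 2 * r) (r / 2).
  apply: (is_derive_eq (is_deriveD1 (K q) (is_deriveM1 (is_deriveM1
    (is_derive_id t 1) (K 2^-1)) (K r)))).
  by rewrite /=; field.
have [-> ->] := linear_flowE P s1 t i; split.
  rewrite (_ : (fun r => _) = fun r => P i 0 + r / 2 * (P i 0 - s * P i 1));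
    last first.
    by apply/funext => r; have [-> _] := linear_flowE P s1 r i.
  apply: (is_derive_eq (DL _ _)).
  transitivity ((P i 0 - s * P i 1) / 2 + t / 4 * (1 - s ^+ 2) * P i 0); last
    by field.
  by rewrite s1; ring.
rewrite (_ : (fun r => _) = fun r => P i 1 + r / 2 * (s * P i 0 - P i 1)); last
  first.
  by apply/funext => r; have [_ ->] := linear_flowE P s1 r i.
apply: (is_derive_eq (DL _ _)).
transitivity ((s * P i 0 - P i 1) / 2 + t / 4 * (1 - s ^+ 2) * P i 1); last by
  field.
by rewrite s1; ring.
Qed.

(** The hypothesis says g P = P (1 + L X), the case t = 0; the rest is (1 + L X)(1 + t X) = 1 + (t +
    L) X. *)
Lemma linear_flow_translates g P s (s1 : s ^+ 2 = 1) (L : R) : 0 < L ->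
  (forall i, g i 0 * P 0 0 + g i 1 * P 1 0 = P i 0 + L / 2 * (P i 0 - s * P i
    1) /\
             g i 0 * P 0 1 + g i 1 * P 1 1 = P i 1 + L / 2 * (s * P i 0 - P i
               1)) ->
  translates (psl_pi g) (base_curve (linear_flow P s1)).
Proof.
move=> L0 H; apply: (translates_base_curve L0) => t.
have E i : (g * linear_flow P s1 t)%g i 0 = linear_flow P s1 (t + L) i 0 /\
   (g * linear_flow P s1 t)%g i 1 = linear_flow P s1 (t + L) i 1.
  rewrite !sl2_mulE; have [-> ->] := linear_flowE P s1 t 0.
  have [-> ->] := linear_flowE P s1 t 1.
  have [-> ->] := linear_flowE P s1 (t + L) i; have [h0 h1] := H i.
  split.
    transitivity ((g i 0 * P 0 0 + g i 1 * P 1 0) + t / 2 * ((g i 0 * P 0 0 + g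
      i 1 * P 1 0)
       - s * (g i 0 * P 0 1 + g i 1 * P 1 1))); first by ring.
    rewrite h0 h1.
    transitivity (P i 0 + (t + L) / 2 * (P i 0 - s * P i 1) + t * L / 4 * (1 -
      s ^+ 2) * P i 0).
      by field.
    by rewrite s1 subrr mulr0 mul0r addr0.
  transitivity ((g i 0 * P 0 1 + g i 1 * P 1 1) + t / 2 * (s * (g i 0 * P 0 0 +
    g i 1 * P 1 0)
     - (g i 0 * P 0 1 + g i 1 * P 1 1))); first by ring.
  rewrite h0 h1.
  transitivity (P i 1 + (t + L) / 2 * (s * P i 0 - P i 1) + t * L / 4 * (1 - s
    ^+ 2) * P i 1).
    by field.
  by rewrite s1 subrr mulr0 mul0r addr0.
by apply: sl2P; [have [] := E 0|have [] := E 0|have [] := E 1|have [] := E 1].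
Qed.

Lemma sgr_sqr (k : R) : k != 0 -> Num.sg k ^+ 2 = 1.
Proof. by move=> k0; rewrite sqr_sg k0. Qed.

(** One has to write g = P (1 + L X) P^-1 with L > 0. The non-identity elements of trace 2 form two
    conjugacy classes, which is why both signs of s occur. *)
Lemma parabolic_adapted g : \tr g = 2 -> psl_pi g <> 1%g -> exists s p,
  [/\ frame_flow s p, translates (psl_pi g) (base_curve p)
    & horocycle (range (base_curve p))].
Proof.
rewrite mxtrace2; have := sl2_det2 g.
move Ea : (g 0 0) => a; move Eb : (g 0 1) => b.
move Ec : (g 1 0) => c; move Ed : (g 1 1) => d D T g1.
have Edd : d = 2 - a by rewrite -T; ring.
have [c0|c0] := eqVneq c 0.
  have a1 : a = 1.
    apply/eqP; rewrite -subr_eq0 -sqrf_eq0; apply/eqP.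
    by transitivity (1 - (a * d - b * c)); [rewrite c0 Edd; ring|rewrite D
      subrr].
  have d1 : d = 1 by rewrite Edd a1; ring.
  have b0 : b != 0.
    apply/eqP => b0; apply: g1; have -> : g = 1%g; last by [].
    by apply: sl2P; rewrite ?Ea ?Eb ?Ec ?Ed ?a1 ?b0 ?c0 ?d1 /= mxE.
  have s1 := sgr_sqr b0; set s := Num.sg b in s1.
  (* Here g - 1 has zero second row, so the second row of P must be killed by X: (1, s). The first
     row is orthogonal to it and gives determinant 1. *)
  have DP : (s / 2) * s - (- 2^-1) * 1 = 1.
    by transitivity ((s ^+ 2 + 1) / 2); [field|rewrite s1; field].
  have [P00 P01 P10 P11] := sl2_ofE DP; set P := sl2_of DP in P00 P01 P10 P11.
  exists s, (linear_flow P s1); split; first exact: frame_flow_linear.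
    apply: (@linear_flow_translates _ _ _ _ (2 * `|b|)).
      by rewrite mulr_gt0 // normr_gt0.
    have bs : s * b = `|b| by rewrite [X in _ * X]numEsg mulrA -expr2 s1 mul1r.
    have bs' : b = s * `|b| by rewrite -numEsg.
    move=> i; case: (ord2P i) => ->.
      rewrite P00 P01 P10 P11 Ea Eb a1; split.
        by rewrite [X in _ + X * 1]bs'; field.
      rewrite -bs; transitivity (- 2^-1 + b * s + (s ^+ 2 - 1) / 2 * (s * b));
        last by field.
      by rewrite s1 subrr mul0r mul0r addr0; field.
    rewrite P00 P01 P10 P11 Ec Ed c0 d1; split.
      transitivity (1 + `|b| * (1 - s ^+ 2)); last by field.
      by rewrite s1; ring.
    by field.
  have E t : base_curve (linear_flow P s1) t = (s * t / 2 +i* 2^-1)%C.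
    rewrite /base_curve; have [n0 -> _] := frame_i_coord (linear_flow P s1 t).
    have [-> ->] := linear_flowE P s1 t 0; have [-> ->] := linear_flowE P s1 t
      1.
    rewrite P00 P01 P10 P11.
    have e0 : 1 - s * s = 0 by rewrite -expr2 s1 subrr.
    have e1 : s * 1 - s = 0 by rewrite mulr1 subrr.
    have e2 : s * (s / 2) = 2^-1 by rewrite mulrA -expr2 s1 mul1r.
    by rewrite e0 e1 e2 !mulr0 !addr0 expr1n s1; congr (_ +i* _)%C; field.
  left; exists (2^-1); first by [].
  apply/seteqP; split=> [z [t _ <-]|z /= Hz]; first by rewrite E.
  exists (2 * s * Re z); first by [].
  rewrite E [RHS]complexRI Hz; congr (_ +i* _)%C.
  transitivity (s ^+ 2 * Re z); first by field.
  by rewrite s1 mul1r.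
(* For P = (1 m; 0 1) the second row of g P = P (1 + L X) reads c = -s L / 2 and c m + d = 1 - L /
   2. Together with L > 0 this dictates s, L = 2 |c| and m. *)
have sg1 := sgr_sqr c0; pose s : R := - Num.sg c.
have s1 : s ^+ 2 = 1 by rewrite sqrrN.
pose k : R := `|c|; have k0 : 0 < k by rewrite normr_gt0.
have k0' : k != 0 by rewrite gt_eqF.
have Ec' : c = - s * k by rewrite opprK -numEsg.
pose m : R := s * (1 - (a - 1) / k).
have DP : 1 * 1 - m * 0 = 1 by ring.
have [P00 P01 P10 P11] := sl2_ofE DP; set P := sl2_of DP in P00 P01 P10 P11.
have s0 : s != 0 by rewrite -sqrf_eq0 s1 oner_eq0.
have Eb' : b = s * (a - 1) ^+ 2 / k.
  apply: (mulfI c0); transitivity (a * d - (a * d - b * c)); first by ring.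
  rewrite D Edd Ec'.
  transitivity (- (s ^+ 2) * (a - 1) ^+ 2); last by field.
  by rewrite s1; ring.
exists s, (linear_flow P s1); split; first exact: frame_flow_linear.
  apply: (@linear_flow_translates _ _ _ _ (2 * k)); first by rewrite mulr_gt0.
  move=> i; case: (ord2P i) => ->; rewrite P00 P01 P10 P11 ?Ea ?Eb ?Ec ?Ed.
    rewrite Eb' /m; split.
      transitivity (1 + k * (1 - s ^+ 2 * (1 - (a - 1) / k))); last by field.
      by rewrite s1; field.
    by field.
  rewrite Ec' Edd /m; split; first by field.
  transitivity (- (s ^+ 2) * (k - (a - 1)) + 2 - a); first by field.
  by rewrite s1; field.
(* The squared norm of the second row of the flow, that is, the reciprocal of the height. *)
pose q t : R := 1 - t + t ^+ 2 / 2.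
have q0 t : q t != 0.
  rewrite (_ : q t = (1 + (1 - t) ^+ 2) / 2); last by rewrite /q; field.
  by rewrite gt_eqF // divr_gt0 // ltr_pwDl // sqr_ge0.
have E t : base_curve (linear_flow P s1) t =
    ((m - s + s * (1 - t) / q t) +i* (q t)^-1)%C.
  rewrite /base_curve; have [n0 -> _] := frame_i_coord (linear_flow P s1 t).
  have [-> ->] := linear_flowE P s1 t 0; have [-> ->] := linear_flowE P s1 t 1.
  rewrite P00 P01 P10 P11.
  have -> : (0 + t / 2 * (0 - s * 1)) ^+ 2 + (1 + t / 2 * (s * 0 - 1)) ^+ 2 = q
    t.
    transitivity (t ^+ 2 / 4 * s ^+ 2 + (1 - t / 2) ^+ 2); first by field.
    by rewrite s1 /q; field.
  congr (_ +i* _)%C; apply: (mulIf (q0 t)); rewrite divfK // [RHS]mulrDl divfK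
    //.
  transitivity ((m - s) * q t + s * (1 - t) + m * t ^+ 2 / 4 * (s ^+ 2 - 1)).
    by rewrite /q; field.
  by rewrite s1 subrr mulr0 addr0.
(* The point of tangency m - s = (a - 1) / c is the fixed point of g on the real axis. *)
right; exists (m - s), 1; first by [].
apply/seteqP; split=> [z [t _ <-]|z /= [y0 Hz]].
  rewrite E /=; split.
    by rewrite invr_gt0 (_ : q t = (1 + (1 - t) ^+ 2) / 2); [rewrite divr_gt0
      // ltr_pwDl // sqr_ge0|rewrite /q; field].
  transitivity ((s ^+ 2 * (1 - t) ^+ 2 + (1 - q t) ^+ 2) / q t ^+ 2); first by
    field.
  by rewrite s1 expr1n; apply: (canLR (mulfK _)); [rewrite sqrf_eq0|rewrite /q;
    field].
have y0' : Im z != 0 by rewrite gt_eqF.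
(* Solved from Re z - (m - s) = s (1 - t) / q(t) and Im z = 1 / q(t). *)
pose t := 1 - s * (Re z - (m - s)) / Im z.
have Eq : q t = (Im z)^-1.
  have X : (Re z - (m - s)) ^+ 2 = 2 * Im z - Im z ^+ 2 by move: Hz; rewrite
    expr1n => Hz; lra.
  transitivity ((1 + s ^+ 2 * (Re z - (m - s)) ^+ 2 / Im z ^+ 2) / 2); first by
    rewrite /q /t; field.
  by rewrite s1 X; field.
exists t; first by [].
rewrite E Eq invrK [RHS]complexRI; congr (_ +i* _)%C.
transitivity (m - s + s ^+ 2 * (Re z - (m - s))); first by rewrite /t; field.
by rewrite s1; ring.
Qed.

End Parabolic.

(** * The positive lift and its action on spin lifts *)

Section Signs.
Variable R : realType.
Implicit Types (g h : SL2 R) (x : PSL2 R) (eta : R -> R[i]) (p : R -> SL2 R).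

Lemma mxtrace_opp g : \tr (sl2_opp g) = - \tr g.
Proof. by rewrite /= raddfN. Qed.

Lemma psl_abstr_pi g : psl_abstr (psl_pi g) = `|\tr g|.
Proof.
rewrite /psl_abstr; have /psl_piP[->//|->] := psl_reprK (psl_pi g).
by rewrite mxtrace_opp normrN.
Qed.

Lemma positive_liftP x : hyperbolic x \/ parabolic x ->
  psl_pi (positive_lift x) = x /\ 2 <= \tr (positive_lift x).
Proof.
move=> hx; have {hx}: 2 <= psl_abstr x by case: hx => [/ltW|[->]].
rewrite /psl_abstr => T; rewrite /positive_lift.
apply: (xgetPex (P := [set g : SL2 R | psl_pi g = x /\ 2 <= \tr g]) 1%g).
have [r0|r0] := leP 0 (\tr (repr x : 'M[R]_2)).
  by exists (repr x); split; [exact: psl_reprK|rewrite -(ger0_norm r0)].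
exists (sl2_opp (repr x)); split; last by rewrite mxtrace_opp -(ltr0_norm r0).
by rewrite -[RHS]psl_reprK; apply/psl_piP; right.
Qed.

(* Both sides are lifts of the same frame, so they agree up to sign, and the
   sign is read off the trace. *)
Lemma translate_spin_lift g eta p (L : R) t s : 2 <= \tr g -> s ^+ 2 <= 1 ->
  unit_speed eta -> constant_moments s eta -> spin_lift eta p ->
  (forall t, psl_act (psl_pi g) (eta t) = eta (t + L)) ->
  (g * p t)%g = p (t + L).
Proof.
move=> T s1 [up /derivable_curveP dv _ _] cu pl H.
have [Ez Ev] := (frame_piP eta t (p t)).1 (pl.2 t).
have [Ez' Ev'] := (frame_piP eta (t + L) (p (t + L))).1 (pl.2 (t + L)).
have i0 : 0 < Im (imagC R) by rewrite /= ltr01.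
have V : velocity eta t / autj g (eta t) ^+ 2 = velocity eta (t + L).
  rewrite -(has_velocityE (has_velocity_mobius g (up t) (dv t))).
  apply: has_velocityE.
  rewrite (_ : (fun r => _) = fun r => eta (r + L)); last first.
    by apply/funext => r; rewrite -H psl_act_pi.
  exact: has_velocity_shift.
have [//|E] : (g * p t)%g = p (t + L) \/ (g * p t)%g = sl2_opp (p (t + L)).
  apply: frame_inj.
    by rewrite mobiusM // Ez Ez' -H psl_act_pi.
  by rewrite autj_mul // Ez Ev' -V -Ev exprMn invfM mulrCA mulrC.
have := spin_lift_trace t (t + L) s1 cu pl.
have -> : p (t + L) = sl2_opp (g * p t)%g by rewrite E sl2_oppK.
rewrite sl2_oppMr mxtrace_opp.
have -> : \tr ((p t)^-1 * (g * p t))%g = \tr g.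
  by rewrite [LHS]mxtrace_mulC -[X in \tr X]/(val (g * p t * (p t)^-1)%g) mulgK.
by move=> T'; have := lerD T T'; rewrite subrr -natrD lern0.
Qed.

(** The matrix p(t)^-1 p(t') fixes i, so it is a rotation, and a rotation of trace at least 2 is the
    identity. This lets t + L be replaced by any t' with the same base point. *)
Lemma spin_lift_inj eta p s t t' : s ^+ 2 <= 1 -> constant_moments s eta ->
  spin_lift eta p -> eta t = eta t' -> p t = p t'.
Proof.
move=> s1 cu pl E.
have [Ez _] := (frame_piP eta t (p t)).1 (pl.2 t).
have [Ez' _] := (frame_piP eta t' (p t')).1 (pl.2 t').
have := spin_lift_trace t t' s1 cu pl.
set M := ((p t)^-1 * p t')%g => T.
have EM : p t' = (p t * M)%g by rewrite mulgA mulgV mul1g.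
have i0 : 0 < Im (imagC R) by rewrite /= ltr01.
have FM : mobius M (imagC R) = imagC R.
  by rewrite mobiusM // Ez' -E -Ez -mobiusM // mulVg mobiusE /autn /autj !mxE /=
     !(mul1r, mul0r, addr0, add0r, divr1).
have [n0] := frame_i_coord M; rewrite FM => + _.
have D := sl2_det2 M; rewrite mxtrace2 in T.
move: T D n0; move Ea : (M 0 0) => a; move Eb : (M 0 1) => b.
move Ec : (M 1 0) => c; move Ed : (M 1 1) => d T D n0.
move=> /eqP; rewrite eq_complex /= => /andP[/eqP h1 /eqP h2].
have n1 : c ^+ 2 + d ^+ 2 = 1 by rewrite -[LHS]invrK -h2 invr1.
move: h1; rewrite n1 divr1 => h1.
have Ha : a = d.
  transitivity (a * (c ^+ 2 + d ^+ 2) - (a * c + b * d) * c).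
    by rewrite n1 -h1; ring.
  by transitivity (d * (a * d - b * c)); [ring|rewrite D mulr1].
have d1 : d = 1 by nra.
have c0 : c = 0 by nra.
have b0 : b = 0 by move: h1; rewrite c0 d1; lra.
rewrite EM (_ : M = 1%g) ?mulg1 //.
by apply: sl2P; rewrite ?Ea ?Eb ?Ec ?Ed ?Ha ?b0 ?c0 ?d1 /= mxE.
Qed.

Lemma adapted_unit_speed x eta : adapted_curve x eta -> unit_speed eta.
Proof. by case=> _ [[_ []]|[_ []]]. Qed.

Lemma adapted_exists x : hyperbolic x \/ parabolic x ->
  exists eta p, adapted_curve x eta /\ spin_lift eta p.
Proof.
move=> hx; have [Ex T] := positive_liftP hx.
have A : psl_abstr x = \tr (positive_lift x).
  by rewrite -{1}Ex psl_abstr_pi ger0_norm //; lra.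
case: (hx) => [hyp|[abs2 x1]].
  have T2 : 2 < \tr (positive_lift x) by rewrite -A.
  have [p [F tr]] := hyperbolic_adapted T2; rewrite Ex in tr.
  exists (base_curve p), p; split; last exact: frame_flow_spin_lift F.
  by split=> //; left; split=> //; exact: frame_flow_geodesic.
have T2 : \tr (positive_lift x) = 2 by rewrite -A.
rewrite -Ex in x1.
have [s [p [F tr hor]]] := parabolic_adapted T2 x1; rewrite Ex in tr x1.
exists (base_curve p), p; split; last exact: frame_flow_spin_lift F.
by split=> //; right; split=> //; split=> //; exact: frame_flow_unit_speed F.
Qed.

Lemma positive_lift_spin_lift x eta p (t t' : R) : hyperbolic x \/ parabolic x
  ->
  adapted_curve x eta -> spin_lift eta p -> eta t' = psl_act x (eta t) ->
  (positive_lift x * p t)%g = p t'.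
Proof.
move=> hx ad pl E; have [Ex T] := positive_liftP hx.
have [s s1 cu] := adapted_constant_moments ad.
have [[L _ HL] _] := ad.
rewrite (@translate_spin_lift (positive_lift x) eta p L t s) //.
- by apply: (spin_lift_inj s1 cu pl); rewrite E HL.
- exact: adapted_unit_speed ad.
by rewrite Ex.
Qed.

End Signs.

Theorem proposition6 (R : realType) (Gamma : set (PSL2 R))
    (rho : PSL2 R -> SL2 R) (chi : SL2 R -> R)
    (hGamma : hyperbolic_surface_group Gamma)
    (hrho : spin_structure Gamma rho)
    (hchi : spin_character Gamma rho chi)
    (gamma : PSL2 R) (hgamma : Gamma gamma)
    (htype : hyperbolic gamma \/ parabolic gamma) :
  nu chi gamma = epsilon rho gamma.
Proof.
have [Ex T] := positive_liftP htype.
have [eta0 [p0 [ad0 pl0]]] := adapted_exists htype.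
(* The two lifts of gamma differ by a sign, and [chi] reads it off, being 1 on rho(gamma) and -1 on
   -I. *)
have E : rho gamma = nu chi gamma *: (positive_lift gamma : 'M[R]_2) :> 'M[R]_2.
  have [_ chiM chiN /(_ _ hgamma) chi1] := hchi; have [_ /(_ _ hgamma) rhoP] :=
    hrho.
  have /psl_piP[Er|Er] : psl_pi (rho gamma) = psl_pi (positive_lift gamma).
    by rewrite Ex rhoP.
    by rewrite /nu -Er chi1 scale1r.
  have Eo : sl2_opp (rho gamma) = positive_lift gamma by rewrite Er sl2_oppK.
  have -> : nu chi gamma = -1.
    rewrite /nu -Eo -[rho gamma]mul1g -sl2_oppMl chiM ?chiN ?chi1 ?mulr1 //.
      rewrite inE /lift_group /= (_ : psl_pi _ = 1%g); last by apply/psl_piP;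
        right.
      by case: hGamma => -[G1 _] _ _ _; rewrite inE in G1.
    by rewrite inE /lift_group /= rhoP.
  by rewrite -Eo scaleN1r /= opprK.
have isE : is_epsilon rho gamma (nu chi gamma).
  split; first by exists eta0, p0.
  move=> eta p ad pl t t' Et.
  by rewrite -(positive_lift_spin_lift htype ad pl Et) /= E scalemxAl.
apply/esym/xget_unique => // e [_ H].
(* Uniqueness: on the existing curve, e and nu(gamma) scale the same matrix p0(L) to the same
   result, and that matrix is nonzero because its determinant is 1. *)
have [[L _ HL] _] := ad0.
have := H eta0 p0 ad0 pl0 0 (0 + L) (esym (HL 0)).
have [_ H'] := isE.
rewrite (H' eta0 p0 ad0 pl0 0 (0 + L) (esym (HL 0))) => /esym/eqP.
rewrite -subr_eq0 -scalerBl scaler_eq0 subr_eq0 => /orP[/eqP //|/eqP p00].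
have := sl2_det (p0 (0 + L)); rewrite p00 det0 => /eqP.
by rewrite eq_sym oner_eq0.
Qed.
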